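(* Fix a stage $k$, the past data $\mathbf Y_{1:k-1}$, and a receive beamforming matrix $\mathbf W_k=[\mathbf w_{k,1},\dots,\mathbf w_{k,M_R}]\in\mathbb C^{N_R\times M_R}$ (with $\mathbf W_k^{\mathsf H}\mathbf W_k$ invertible), and put $\mathbf R_{\mathbf W_k}=\mathbf W_k(\mathbf W_k^{\mathsf H}\mathbf W_k)^{-1}\mathbf W_k^{\mathsf H}$. Consider the problem $$\text{(A)}\quad \min_{\mathbf R_{\mathbf V}\in\mathbb C^{N_T\times N_T},\ d_1,\dots,d_{3L}\in\mathbb R}\ \sum_{\ell=1}^{3L}d_\ell\quad\text{s.t.}\quad \begin{bmatrix}\mathbf J_k(\mathbf R_{\mathbf V},\mathbf R_{\mathbf W_k})&\sqrt{q_\ell}\,\mathbf e_\ell\\ \sqrt{q_\ell}\,\mathbf e_\ell^{\mathsf T}&d_\ell\end{bmatrix}\succeq 0\ \ \forall \ell,$$ $$\mathrm{tr}(\mathbf R_{\mathbf V})\le P,\quad \mathrm{rank}(\mathbf R_{\mathbf V})\le M_T,\quad \mathbf R_{\mathbf V}\succeq 0 .$$ Let $\tilde{\mathbf\Lambda}^*$ denote the solution (maximizer) of $$\max_{\mathbf\Lambda\in\mathbb R^{3L\times 3L}}\ 2\,\mathrm{tr}(\mathbf\Lambda\mathbf Q^{1/2})-\mathrm{tr}\big(\mathbf\Lambda^{\mathsf T}\mathbf J_{k-1}^{(\mathsf P)}\mathbf\Lambda\big)-2P\,\mu_1\big(\tilde{\mathbf P}_{\mathbf\Lambda\mathbf\Lambda^{\mathsf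 T}}\big),$$ where $\tilde{\mathbf P}_{\mathbf\Lambda\mathbf\Lambda^{\mathsf T}}=\sum_{m=1}^{M_R}\mathbb E\big[\dot{\tilde{\mathbf G}}_{k,m}(\boldsymbol\theta)\mathbf\Lambda\mathbf\Lambda^{\mathsf T}\dot{\tilde{\mathbf G}}_{k,m}^{\mathsf H}(\boldsymbol\theta)\,\big|\,\mathbf Y_{1:k-1}\big]$ and $\dot{\tilde{\mathbf G}}_{k,m}(\boldsymbol\theta)=\big[\dot{\mathbf H}_1^{\mathsf H}(\boldsymbol\theta)\mathbf w_{k,m}\ \cdots\ \dot{\mathbf H}_{3L}^{\mathsf H}(\boldsymbol\theta)\mathbf w_{k,m}\big]$, $\mathbf w_{k,m}$ being the $m$-th column of $\mathbf W_k$. If $\mu_{1}(\tilde{\mathbf P}_{\tilde{\mathbf\Lambda}^*(\tilde{\mathbf\Lambda}^* )^{\mathsf T}})>\mu_{2}(\tilde{\mathbf P}_{\tilde{\mathbf\Lambda}^*(\tilde{\mathbf\Lambda}^* )^{\mathsf T}})$, then the semidefinite relaxation of (A), given by $$\min_{\mathbf R_{\mathbf V},\ d_1,\dots,d_{3L}}\ \sum_{\ell=1}^{3L}d_\ell\quad\text{s.t.}\quad \begin{bmatrix}\mathbf J_k(\mathbf R_{\mathbf V},\mathbf R_{\mathbf W_k})&\sqrt{q_\ell}\,\mathbf e_\ell\\ \sqrt{q_\ell}\,\mathbf e_\ell^{\mathsf T}&d_\ell\end{bmatrix}\succeq 0\ \ \forall \ell,\quad \mathrm{tr}(\mathbf R_{\mathbf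 V})\le P,\quad \mathbf R_{\mathbf V}\succeq 0,$$ is tight, i.e., it has the same optimal value as (A).
   Context: Notation: $\mu_i(\cdot)$ is the $i$-th largest eigenvalue (with multiplicity) of a Hermitian matrix; $\mathbf e_\ell$ is the $\ell$-th column of $\mathbf I_{3L}$; $\succeq$ is the positive semidefinite order; $\imath=\sqrt{-1}$. Model: integers $L\ge1$, $1\le M_T<N_T$, $1\le M_R<N_R$; power $P>0$; weights $q_1,\dots,q_{3L}\ge 0$ with $\sum_\ell q_\ell=1$, $\mathbf Q=\mathrm{diag}(q_1,\dots,q_{3L})$. The random parameter is $\boldsymbol\theta=[\boldsymbol\phi^{\mathsf T},\mathrm{Re}\,\boldsymbol\alpha^{\mathsf T},\mathrm{Im}\,\boldsymbol\alpha^{\mathsf T}]^{\mathsf T}\in\mathbb R^{3L}$ with prior density $f(\boldsymbol\theta)$: $\phi_i$ is uniform on $[\phi_{\min},\phi_{\max}]$, and $\alpha_i\sim\mathcal{CN}(0,1)$ are i.i.d. and independent of $\boldsymbol\phi$. The response matrix is $\mathbf H(\boldsymbol\theta)=\sum_{i=1}^L\alpha_i\mathbf a_{\rm R}(\phi_i)\mathbf a_{\rm T}^{\mathsf H}(\phi_i)\in\mathbb C^{N_R\times N_T}$, $\mathbf a_{\rm S}(\phi)=[1,e^{\imath\pi\sin\phi},\dots,e^{\imath(N_{\rm S}-1)\pi\sin\phi}]^{\mathsf T}$ for ${\rm S}\in\{{\rm R},{\rm T}\}$, and $\dot{\mathbf H}_i(\boldsymbol\theta)=\partial\mathbf H(\boldsymbol\theta)/\partial\theta_i$.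 Past measurements are $\mathbf Y_\ell=\mathbf W_\ell^{\mathsf H}\mathbf H(\boldsymbol\theta)\mathbf V_\ell+\mathbf W_\ell^{\mathsf H}\mathbf Z_\ell$, $\ell=1,\dots,k-1$, where $\mathbf V_\ell\in\mathbb C^{N_T\times M_T}$, $\mathbf W_\ell\in\mathbb C^{N_R\times M_R}$ (with $\mathbf W_\ell^{\mathsf H}\mathbf W_\ell$ invertible) are known functions of the earlier measurements and $\mathbf Z_\ell$ has i.i.d. $\mathcal{CN}(0,1)$ entries, independent of everything else. $\mathbb E[\cdot\mid\mathbf Y_{1:k-1}]$ is expectation under the posterior of $\boldsymbol\theta$ given $\mathbf Y_{1:k-1}=(\mathbf Y_1,\dots,\mathbf Y_{k-1})$. Bayesian Fisher information matrix (BFIM): for Hermitian $\mathbf R_{\mathbf V}\in\mathbb C^{N_T\times N_T}$, $\mathbf R_{\mathbf W}\in\mathbb C^{N_R\times N_R}$, $\mathbf J_k(\mathbf R_{\mathbf V},\mathbf R_{\mathbf W})=\mathbf J_k^{(\mathsf D)}(\mathbf R_{\mathbf V},\mathbf R_{\mathbf W})+\mathbf J_{k-1}^{(\mathsf P)}$, a $3L\times 3L$ matrix, where $$[\mathbf J_k^{(\mathsf D)}(\mathbf R_{\mathbf V},\mathbf R_{\mathbf W})]_{i,j}=2\,\mathrm{Re}\,\mathrm{tr}\,\mathbb E\big[\mathbf R_{\mathbf W}\dot{\mathbf H}_i(\boldsymbol\theta)\mathbf R_{\mathbf V}\dot{\mathbf H}_j^{\mathsf H}(\boldsymbol\theta)\mid\mathbf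 Y_{1:k-1}\big],\qquad [\mathbf J_{k-1}^{(\mathsf P)}]_{i,j}=-\mathbb E\Big[\tfrac{\partial^2\log f(\boldsymbol\theta\mid\mathbf Y_{1:k-1})}{\partial\theta_i\partial\theta_j}\Big|\mathbf Y_{1:k-1}\Big].$$ $\mathbf J_{k-1}^{(\mathsf P)}$ does not depend on the stage-$k$ beamformers. Standing identifiability assumption: in each stage $k$ there exist transmit and receive beamforming matrices $\mathbf V,\mathbf W$ for which the BFIM $\mathbf J_k(\mathbf V\mathbf V^{\mathsf H},\mathbf W(\mathbf W^{\mathsf H}\mathbf W)^{-1}\mathbf W^{\mathsf H})$ is invertible.
   Formalization: The matrix P̃ and the dual objective are built from the columns of an orthonormal basis of the range of W_k instead of the columns w_{k,m} themselves; the two agree when W_k^H W_k = I, and with unnormalised columns the claim fails. *)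

(* Defs.v *)
From HB Require Import structures.
From mathcomp Require Import all_boot all_order all_algebra.
From mathcomp Require Import complex.
From mathcomp Require Import all_classical all_reals all_analysis.

Set Implicit Arguments.
Unset Strict Implicit.
Unset Printing Implicit Defensive.

Import Order.TTheory GRing.Theory Num.Theory.
Import numFieldNormedType.Exports.

Local Open Scope classical_set_scope.
Local Open Scope ring_scope.
Local Open Scope complex_scope.
Local Open Scope sesquilinear_scope.

(* n-fold product of a sigma-finite measure, carried by n-tuples; applied below to
   Lebesgue measure on R to get Lebesgue measure on R^n. *)
Section product_power.
Context d (T : measurableType d) (R : realType).
Variable m : {sigma_finite_measure set T -> \bar R}.

Section cons_measure.
Variables (n : nat) (mn : {sigma_finite_measure set (n.-tuple T) -> \bar R}).

Let cons_pair (p : T * n.-tuple T) : n.+1.-tuple T :=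
  [the n.+1.-tuple T of p.1 :: p.2].

Let measurable_cons_pair : measurable_fun [set: T * n.-tuple T] cons_pair.
Proof. exact: measurable_cons. Qed.

Definition cons_measure : set (n.+1.-tuple T) -> \bar R :=
  pushforward (m \x mn)%E cons_pair.

Let cons_measure0 : cons_measure set0 = 0%E.
Proof. by rewrite /cons_measure /pushforward preimage_set0 measure0. Qed.

Let cons_measure_ge0 A : (0 <= cons_measure A)%E.
Proof. exact: measure_ge0. Qed.

Let cons_measure_sigma_additive : semi_sigma_additive cons_measure.
Proof.
move=> F mF tF mUF; rewrite /cons_measure /pushforward preimage_bigcup.
apply: measure_semi_sigma_additive.
- by move=> k; rewrite -[X in measurable X]setTI; exact: measurable_cons_pair.
- apply/trivIsetP => /= i j _ _ ij; rewrite -preimage_setI.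
  by move/trivIsetP : tF => /(_ _ _ _ _ ij) ->//; rewrite preimage_set0.
- rewrite -preimage_bigcup -[X in measurable X]setTI.
  exact: measurable_cons_pair.
Qed.

HB.instance Definition _ := isMeasure.Build _ _ _ cons_measure
  cons_measure0 cons_measure_ge0 cons_measure_sigma_additive.

Let cons_measure_sigma_finite : sigma_finite setT cons_measure.
Proof.
have /sigma_finiteP[F [TF ndF Foo]] := sigma_finiteT m.
have /sigma_finiteP[G [TG ndG Goo]] := sigma_finiteT mn.
pose split_tuple (t : n.+1.-tuple T) : T * n.-tuple T :=
  (thead t, [tuple of behead t]).
have ms : measurable_fun [set: n.+1.-tuple T] split_tuple.
  apply: measurable_fun_pair; last exact: measurable_behead.
  exact: measurable_tnth.
have splitK p : split_tuple (cons_pair p) = p.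
  by case: p => x t; congr pair; exact/val_inj.
exists (fun k => split_tuple @^-1` (F k `*` G k)).
  rewrite -preimage_bigcup [X in _ @^-1` X](_ : _ = setT) ?preimage_setT//.
  rewrite -setXTT TF TG predeqE => -[x y]; split.
    by move=> [j _ []/= ? ?]; split; exists j.
  move=> [/= [i _ Fix] [j _ Gjy]]; exists (maxn i j) => //; split.
  - by move: x Fix; exact/subsetPset/ndF/leq_maxl.
  - by move: y Gjy; exact/subsetPset/ndG/leq_maxr.
move=> k; have [? ?] := Foo k; have [? ?] := Goo k; split.
  by rewrite -[X in measurable X]setTI; apply: ms => //; exact: measurableX.
rewrite /cons_measure /pushforward -comp_preimage.
rewrite (_ : split_tuple \o cons_pair = id) ?preimage_id; last first.
  exact/funext/splitK.
by rewrite product_measure1E// lte_mul_pinfty// ge0_fin_numE.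
Qed.

HB.instance Definition _ := Measure_isSigmaFinite.Build _ _ _ cons_measure
  cons_measure_sigma_finite.

End cons_measure.

Fixpoint power_measure (n : nat) :
    {sigma_finite_measure set (n.-tuple T) -> \bar R} :=
  match n return {sigma_finite_measure set (n.-tuple T) -> \bar R} with
  | 0 => \d_([tuple] : 0.-tuple T)
  | n'.+1 => cons_measure (power_measure n')
  end.

End product_power.

Section matrices.
Variable R : realType.
Notation C := R[i].

Definition psdC n (A : 'M[C]_n) : Prop :=
  A^t* = A /\ forall x : 'cV[C]_n, 0 <= (x^t* *m A *m x) 0 0.

Definition psdR n (A : 'M[R]_n) : Prop :=
  A^T = A /\ forall x : 'cV[R]_n, 0 <= (x^T *m A *m x) 0 0.

(* mu i A is the i-th largest eigenvalue of the Hermitian matrix A, counted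
   with multiplicity and numbered from 1. *)
Definition mu n (i : nat) (A : 'M[C]_n) : R :=
  nth 0 (sort (fun x y : R => y <= x)
           [seq complex.Re (spectral_diag A 0 j) | j <- enum 'I_n]) i.-1.

Definition proj_range m n (W : 'M[C]_(m, n)) : 'M[C]_m :=
  W *m invmx (W^t* *m W) *m W^t*.

End matrices.

Section model.
Variable R : realType.
Notation C := R[i].

Definition integral_rV n (g : 'rV[R]_n -> R) : R :=
  \int[power_measure (@lebesgue_measure R) n]_t g (\row_i tnth t i).

Definition partial n (i : 'I_n) (g : 'rV[R]_n -> R) (theta : 'rV[R]_n) : R :=
  'D_(delta_mx 0 i) g theta.

Variable L : nat.

(* L + (L + L) plays the role of 3L: the blocks of theta are phi, Re alpha and
   Im alpha. *)
Notation dim := (L + (L + L))%N.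

Definition phi (theta : 'rV[R]_dim) (i : 'I_L) : R := lsubmx theta 0 i.
Definition alpha_re (theta : 'rV[R]_dim) (i : 'I_L) : R :=
  lsubmx (rsubmx theta) 0 i.
Definition alpha_im (theta : 'rV[R]_dim) (i : 'I_L) : R :=
  rsubmx (rsubmx theta) 0 i.

Definition steering N (x : R) : 'cV[C]_N :=
  \col_(n < N) (cos (n%:R * pi * sin x) +i* sin (n%:R * pi * sin x)).

Section response.
Variables NR NT : nat.

Definition response (theta : 'rV[R]_dim) : 'M[C]_(NR, NT) :=
  \sum_(i < L) (alpha_re theta i +i* alpha_im theta i) *:
     (steering NR (phi theta i) *m (steering NT (phi theta i))^t*).

Definition dresponse (i : 'I_dim) (theta : 'rV[R]_dim) : 'M[C]_(NR, NT) :=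
  \matrix_(r, c)
    (partial i (fun t => complex.Re (response t r c)) theta +i*
     partial i (fun t => complex.Im (response t r c)) theta).

End response.

(* The angles are independent, each uniform on [phimin, phimax]. *)
Definition prior_pdf (phimin phimax : R) (theta : 'rV[R]_dim) : R :=
  \prod_(i < L)
    (uniform_pdf phimin phimax (phi theta i) *
     (* CN(0, 1): real and imaginary parts are independent N(0, 1/2) *)
     (normal_pdf 0 (Num.sqrt 2^-1) (alpha_re theta i) *
      normal_pdf 0 (Num.sqrt 2^-1) (alpha_im theta i))).

Section posterior.
Variables (NT NR MT MR : nat) (phimin phimax : R).
Notation obs := 'M[C]_(MR, MT).
Variables (V : seq obs -> 'M[C]_(NT, MT)) (W : seq obs -> 'M[C]_(NR, MR)).

(* Density at y of W^H H V + W^H Z with respect to Lebesgue measure on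
   C^(MR x MT): the columns of W^H Z are i.i.d. CN(0, W^H W). *)
Definition obs_pdf (v : 'M[C]_(NT, MT)) (w : 'M[C]_(NR, MR)) (y : obs)
    (theta : 'rV[R]_dim) : R :=
  let K := w^t* *m w in
  let e := y - w^t* *m response NR NT theta *m v in
  expR (- complex.Re (\tr (e^t* *m invmx K *m e))) /
    (pi ^+ (MR * MT) * complex.Re (\det K) ^+ MT).

Variables (m : nat) (Y : m.-tuple obs).

(* The beamformers producing the observation number l are functions of the
   observations preceding it. *)
Definition likelihood (theta : 'rV[R]_dim) : R :=
  \prod_(l < m) obs_pdf (V (take l Y)) (W (take l Y)) (tnth Y l) theta.

Definition joint_pdf (theta : 'rV[R]_dim) : R :=
  prior_pdf phimin phimax theta * likelihood theta.

Definition posterior_pdf (theta : 'rV[R]_dim) : R :=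
  joint_pdf theta / integral_rV joint_pdf.

End posterior.

Section bfim.
Variables (NT NR MR : nat) (f : 'rV[R]_dim -> R).

Definition expect (g : 'rV[R]_dim -> R) : R :=
  integral_rV (fun theta => g theta * f theta).

Definition expect_mx p n (A : 'rV[R]_dim -> 'M[C]_(p, n)) : 'M[C]_(p, n) :=
  \matrix_(i, j) (expect (fun theta => complex.Re (A theta i j)) +i*
                  expect (fun theta => complex.Im (A theta i j))).

Definition JD (RV : 'M[C]_NT) (RW : 'M[C]_NR) : 'M[R]_dim :=
  \matrix_(i, j) (2 * complex.Re (\tr (expect_mx (fun theta =>
     RW *m dresponse NR NT i theta *m RV *m (dresponse NR NT j theta)^t*)))).

(* Where f vanishes the weight of the expectation is 0, so the value of ln there
   is irrelevant; the boundary of the support of f is a null set. *)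
Definition JP : 'M[R]_dim :=
  \matrix_(i, j)
    - expect (partial i (partial j (fun theta => ln (f theta)))).

Definition J (RV : 'M[C]_NT) (RW : 'M[C]_NR) : 'M[R]_dim := JD RV RW + JP.

Definition Gdot (w : 'cV[C]_NR) (theta : 'rV[R]_dim) : 'M[C]_(NT, dim) :=
  \matrix_(r, i) (((dresponse NR NT i theta)^t* *m w) r 0).

(* The sum over m of w_m w_m^H is the projector proj_range W only when W has
   orthonormal columns; it is then that the trace of Ptilde W S against RV pairs
   with JD RV (proj_range W). The argument W of Ptilde and dual_objective is
   therefore meant to be an orthonormal basis of the range of the beamformer. *)
Definition Ptilde (W : 'M[C]_(NR, MR)) (S : 'M[R]_dim) : 'M[C]_NT :=
  \sum_(m < MR) expect_mx (fun theta =>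
     Gdot (col m W) theta *m map_mx (real_complex R) S *m
     (Gdot (col m W) theta)^t*).

Variables (P : R) (q : 'I_dim -> R).

Definition sqrtQ : 'M[R]_dim := diag_mx (\row_l Num.sqrt (q l)).

Definition dual_objective (W : 'M[C]_(NR, MR)) (Lam : 'M[R]_dim) : R :=
  2 * \tr (Lam *m sqrtQ) - \tr (Lam^T *m JP *m Lam)
    - 2 * P * mu 1 (Ptilde W (Lam *m Lam^T)).

Definition sdr_feasible (RW : 'M[C]_NR) (x : 'M[C]_NT * ('I_dim -> R)) : Prop :=
  let: (RV, d) := x in
  [/\ forall l, psdR (block_mx
          (J RV RW)                            (Num.sqrt (q l) *: delta_mx l 0)
          (Num.sqrt (q l) *: delta_mx 0 l)     (d l)%:M : 'M[R]_(dim + 1)),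
      \tr RV <= P%:C
    & psdC RV].

Definition rank_feasible (MT : nat) (RW : 'M[C]_NR)
    (x : 'M[C]_NT * ('I_dim -> R)) : Prop :=
  sdr_feasible RW x /\ (\rank x.1 <= MT)%N.

(* Value of min sum_l d_l over the feasible set F; it is +oo if F is empty. *)
Definition optimal_value (F : 'M[C]_NT * ('I_dim -> R) -> Prop) : \bar R :=
  ereal_inf [set (\sum_l x.2 l)%:E | x in [set x | F x]].

End bfim.

End model.

(* Main.v *)
(* Put M_ij = E[Hdot_i^H U U^H Hdot_j | Y]. Then Ptilde(S) = sum_ij S_ij M_ij and
   JD(RV)_ij = 2 Re tr(M_ji RV), so the dual objective at any Lam bounds the
   relaxation from below. Let v be a unit top eigenvector of Ptilde(Lam Lam^T) at
   the maximizer Lam. The eigenvalue gap makes mu_1 differentiable there, and the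
   first-order condition reads J(RV) Lam = Q^(1/2) for RV = P v v^H. Hence
   d_l = lam_l^T J(RV) lam_l attains the bound with RV of rank one, as soon as
   J(RV) is positive semidefinite. This does not follow from concavity, since the
   prior information matrix may be indefinite: on the range of Lam it follows from
   the optimality of Lam among its images under reflections, and if Lam is
   singular it follows from perturbing Lam by x c^T with Lam c = 0. *)
Require Import Defs.
From HB Require Import structures.
From mathcomp Require Import all_boot all_order all_algebra.
From mathcomp Require Import complex.
From mathcomp Require Import all_classical all_reals all_analysis.
From mathcomp Require Import measurable_realfun ring lra.

Set Implicit Arguments.
Unset Strict Implicit.
Unset Printing Implicit Defensive.

Import Order.TTheory GRing.Theory Num.Theory.
Import numFieldNormedType.Exports.

Local Open Scope classical_set_scope.
Local Open Scope ring_scope.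
Local Open Scope complex_scope.
Local Open Scope sesquilinear_scope.

(** * Hermitian forms and the largest eigenvalue *)

(** No derivative of mu_1 is ever taken. Since mu_1 enters the dual objective with a minus sign,
    maximality at Lam can be exploited through an upper bound of mu_1 along a perturbation: a linear
    term given by v, plus an error of order t^2. The vector v is fixed before the direction, so that
    one matrix RV serves all first-order conditions at once. The columns of Lam act as multipliers:
    weak duality tests the constraint number l on the vector (lam_l, -1). The analytic burden lies
    in identifying the abstract matrices M_ij with the model. Sums and constant matrices have to
    cross the expectation, and the integral is linear only on integrable functions. Products of two
    response derivatives are therefore shown integrable under the posterior: the derivatives grow at
    most linearly in the path gains, the likelihood is bounded, and the prior has product form. The
    prior information matrix, in contrast, is carried along as an opaque matrix of which only the
    symmetry is used. *)

Section complex_forms.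
Variable R : realType.
Notation C := R[i].
Implicit Types x y z : C.

Lemma ReD x y : complex.Re (x + y) = complex.Re x + complex.Re y.
Proof. by case: x y => [? ?] [? ?]. Qed.

Lemma ImD x y : complex.Im (x + y) = complex.Im x + complex.Im y.
Proof. by case: x y => [? ?] [? ?]. Qed.

Lemma ReN x : complex.Re (- x) = - complex.Re x.
Proof. by case: x. Qed.

Lemma Re_sum I (r : seq I) (Q : pred I) (F : I -> C) :
  complex.Re (\sum_(i <- r | Q i) F i) = \sum_(i <- r | Q i) complex.Re (F i).
Proof. exact: (big_morph _ ReD). Qed.

Lemma ReC_mul (a : R) x : complex.Re (a%:C * x) = a * complex.Re x.
Proof. by case: x => [b c] /=; rewrite mul0r subr0. Qed.

Lemma cRe_conj x : complex.Re (Num.conj x) = complex.Re x.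
Proof. by case: x. Qed.

Lemma cIm_conj x : complex.Im (Num.conj x) = - complex.Im x.
Proof. by case: x. Qed.

Lemma conj_RC (a : R) : Num.conj (a%:C) = a%:C :> C.
Proof. by rewrite /Num.conj /= oppr0. Qed.

Lemma trCM m n p (A : 'M[C]_(m, n)) (B : 'M[C]_(n, p)) :
  (A *m B)^t* = B^t* *m A^t*.
Proof. by rewrite trmx_mul map_mxM. Qed.

Lemma trCK m n (A : 'M[C]_(m, n)) : (A^t*)^t* = A.
Proof. exact: trmxCK. Qed.

Lemma trCE m n (A : 'M[C]_(m, n)) i j : (A^t*) i j = Num.conj (A j i).
Proof. by rewrite !mxE. Qed.

Lemma trCD m n (A B : 'M[C]_(m, n)) : (A + B)^t* = A^t* + B^t*.
Proof. by apply/matrixP => i j; rewrite !mxE rmorphD. Qed.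

Lemma trCZ m n (a : C) (A : 'M[C]_(m, n)) : (a *: A)^t* = Num.conj a *: A^t*.
Proof. by apply/matrixP => i j; rewrite !mxE rmorphM. Qed.

Lemma trC_sum m n I (r : seq I) (Q : pred I) (F : I -> 'M[C]_(m, n)) :
  (\sum_(i <- r | Q i) F i)^t* = \sum_(i <- r | Q i) (F i)^t*.
Proof.
apply: (big_morph (fun A : 'M[C]_(m, n) => A^t*) (@trCD m n)).
by apply/matrixP => i j; rewrite !mxE rmorph0.
Qed.

Definition cdot n (u w : 'cV[C]_n) : C := (u^t* *m w) 0 0.
Definition form n (B : 'M[C]_n) (u w : 'cV[C]_n) : R :=
  complex.Re ((u^t* *m B *m w) 0 0).
Definition sqn z : R := complex.Re z ^+ 2 + complex.Im z ^+ 2.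
Definition sqnorm n (u : 'cV[C]_n) : R := \sum_i sqn (u i 0).

Lemma sqn_ge0 z : 0 <= sqn z.
Proof. by rewrite addr_ge0// sqr_ge0. Qed.

Lemma sqnorm_ge0 n (u : 'cV[C]_n) : 0 <= sqnorm u.
Proof. by apply: sumr_ge0 => i _; exact: sqn_ge0. Qed.

Lemma sqn_conjM z : Num.conj z * z = (sqn z)%:C.
Proof.
by case: z => a b; rewrite /Num.conj/= /sqn/=; congr Complex; rewrite /=; ring.
Qed.

Lemma cdotxx n (u : 'cV[C]_n) : cdot u u = (sqnorm u)%:C.
Proof.
rewrite /cdot mxE /sqnorm rmorph_sum; apply: eq_bigr => i _.
by rewrite trCE sqn_conjM.
Qed.

Lemma formDl n B (u v w : 'cV[C]_n) : form B (u + v) w = form B u w + form B v w.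
Proof. by rewrite /form trCD !mulmxDl mxE ReD. Qed.

Lemma formDr n B (u v w : 'cV[C]_n) : form B u (v + w) = form B u v + form B u w.
Proof. by rewrite /form mulmxDr mxE ReD. Qed.

Lemma formZl n B a (u w : 'cV[C]_n) : form B (a%:C *: u) w = a * form B u w.
Proof. by rewrite /form trCZ conj_RC -!scalemxAl mxE ReC_mul. Qed.

Lemma formZr n B a (u w : 'cV[C]_n) : form B u (a%:C *: w) = a * form B u w.
Proof. by rewrite /form -scalemxAr mxE ReC_mul. Qed.

Lemma formD n A B (u w : 'cV[C]_n) : form (A + B) u w = form A u w + form B u w.
Proof. by rewrite /form mulmxDr mulmxDl mxE ReD. Qed.

Lemma formZ n a A (u w : 'cV[C]_n) : form (a%:C *: A) u w = a * form A u w.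
Proof. by rewrite /form -scalemxAr -scalemxAl mxE ReC_mul. Qed.

Lemma form1 n (u : 'cV[C]_n) : form 1%:M u u = sqnorm u.
Proof. by rewrite /form mulmx1 -/(cdot u u) cdotxx. Qed.

Lemma form_herm n A (u w : 'cV[C]_n) : A^t* = A -> form A u w = form A w u.
Proof.
move=> hA; rewrite /form -[in LHS]cRe_conj.
by rewrite -(@trCE 1 1 (u^t* *m A *m w)) !trCM trCK hA mulmxA.
Qed.

Lemma formE n A (u w : 'cV[C]_n) :
  form A u w = \sum_i \sum_j complex.Re (Num.conj (u i 0) * A i j * w j 0).
Proof.
rewrite /form mxE Re_sum exchange_big; apply: eq_bigr => j _.
rewrite mxE big_distrl Re_sum; apply: eq_bigr => i _ /=.
by rewrite trCE.
Qed.

(** Young's inequality, entry by entry: [s] times the gap for one entry is the squared modulus of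
    [s * a - b * c]. The factor [n] counts how often an entry of [u] recurs in the double sum. The
    free weight [s] is tuned later against the spectral gap. *)
Lemma form_le n (s : R) A (u w : 'cV[C]_n) : 0 < s ->
  2 * form A u w <=
    s * n%:R * sqnorm u + s^-1 * (\sum_i \sum_j sqn (A i j)) * sqnorm w.
Proof.
move=> s0.
have entry a b c : 2 * complex.Re (Num.conj a * b * c) <=
    s * sqn a + s^-1 * sqn b * sqn c.
  rewrite -(ler_pM2l s0).
  have -> : s * (s * sqn a + s^-1 * sqn b * sqn c) =
            s ^+ 2 * sqn a + sqn b * sqn c by field; rewrite gt_eqF.
  case: a b c => [a1 a2] [b1 b2] [c1 c2]; rewrite /Num.conj /sqn /=.
  rewrite -subr_ge0; set X := (X in 0 <= X).
  have -> : X = (s * a1 - (b1 * c1 - b2 * c2)) ^+ 2 +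
                (s * a2 - (b1 * c2 + b2 * c1)) ^+ 2 by rewrite /X; ring.
  by rewrite addr_ge0// sqr_ge0.
rewrite formE mulr_sumr.
have -> : s * n%:R * sqnorm u = \sum_i \sum_(j < n) s * sqn (u i 0).
  rewrite /sqnorm mulr_sumr; apply: eq_bigr => i _.
  by rewrite sumr_const card_ord -mulr_natr; ring.
have h : \sum_i \sum_j s^-1 * sqn (A i j) * sqn (w j 0) <=
    s^-1 * (\sum_i \sum_j sqn (A i j)) * sqnorm w.
  rewrite -mulrA mulr_suml mulr_sumr; apply: ler_sum => i _.
  rewrite mulr_suml mulr_sumr; apply: ler_sum => j _; rewrite mulrA.
  apply: ler_wpM2l; first by rewrite mulr_ge0 ?invr_ge0 ?sqn_ge0// ltW.
  rewrite /sqnorm (bigD1 j)//= lerDl.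
  by apply: sumr_ge0 => *; exact: sqn_ge0.
apply: (le_trans _ (lerD (lexx _) h)).
rewrite -big_split; apply: ler_sum => i _ /=.
by rewrite mulr_sumr -big_split; apply: ler_sum => j _; exact: entry.
Qed.

Lemma herm_spectral n (A : 'M[C]_n) : A^t* = A ->
  exists e : 'I_n -> 'cV[C]_n,
  [/\ forall i j, cdot (e i) (e j) = (i == j)%:R,
      forall x : 'cV[C]_n, sqnorm x = \sum_j sqn (cdot (e j) x) &
      forall x : 'cV[C]_n, form A x x =
        \sum_j complex.Re (spectral_diag A 0 j) * sqn (cdot (e j) x)].
Proof.
move=> hA.
have hH : A \is hermsymmx.
  by apply/is_hermitianmxP; rewrite expr0 scale1r.
have /orthomx_spectralP hS := hermitian_normalmx hH.
set S := spectralmx A in hS; set d := spectral_diag A in hS *.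
have uS : S \is unitarymx := spectral_unitarymx A.
have dreal j : d 0 j = (complex.Re (d 0 j))%:C.
  have /mxOverP/(_ 0 j) dr := hermitian_spectral_diag_real hH.
  by rewrite RRe_real.
have hSx (x : 'cV[C]_n) j : cdot ((row j S)^t*) x = (S *m x) j 0.
  by rewrite /cdot trCK -row_mul mxE.
have hSS : S^t* *m S = 1%:M.
  by rewrite -invmx_unitary// mulVmx// spectral_unit.
(* The factorization reads A = S^H D S, so the eigenvectors are the conjugated rows of [S]. *)
exists (fun j => (row j S)^t*); split.
- move=> i j; rewrite /cdot trCK.
  have /matrixP/(_ i j) := unitarymxP uS.
  rewrite !mxE => <-; apply: eq_bigr => k _.
  by rewrite !mxE.
- move=> x; rewrite -form1 /form -hSS !mulmxA.
  rewrite -mulmxA -trCM -/(cdot _ _) cdotxx /=.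
  by apply: eq_bigr => j _; rewrite hSx.
- move=> x; rewrite /form {1}hS invmx_unitary// !mulmxA -trCM.
  rewrite -mulmxA mxE Re_sum; apply: eq_bigr => j _.
  rewrite mul_mx_diag mxE trCE hSx [d 0 j]dreal.
  rewrite mulrAC mulrC ReC_mul.
  by rewrite sqn_conjM.
Qed.

Lemma herm_gap n (A : 'M[C]_n) : (0 < n)%N -> A^t* = A ->
  exists v : 'cV[C]_n, [/\ sqnorm v = 1, form A v v = mu 1 A,
    forall x : 'cV[C]_n, form A x x <= mu 1 A * sqnorm x &
    forall x : 'cV[C]_n, form A x x <=
      mu 1 A * sqnorm x - (mu 1 A - mu 2 A) * (sqnorm x - sqn (cdot v x))].
Proof.
move=> n0 hA; have [e [he hn hf]] := herm_spectral hA.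
pose d j := complex.Re (spectral_diag A 0 j).
(* Sorting indices instead of eigenvalues keeps track of which eigenvector belongs to which
   position. *)
pose t := sort (relpre d (fun x y : R => y <= x)) (enum 'I_n).
have mut i : mu i A = nth 0 (map d t) i.-1 by rewrite /mu sort_map.
have st : sorted (fun x y : R => y <= x) (map d t).
  by rewrite sorted_map; apply: sort_sorted => i j; exact: le_total.
have tr : transitive (fun x y : R => y <= x).
  by move=> a b c /= ab bc; exact: le_trans bc ab.
have size_t : size t = n by rewrite size_sort size_enum_ord.
have j00 := Ordinal n0; pose j0 := nth j00 t 0.
have mu1 : mu 1 A = d j0 by rewrite mut (nth_map j00) ?size_t.
have le_mu k j : (k <= index j t)%N -> d j <= mu k.+1 A.
  move=> kj; have jt : j \in t by rewrite mem_sort mem_enum.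
  have jn : (index j t < n)%N by rewrite -[ltnRHS]size_t index_mem.
  rewrite mut -[leLHS](congr1 d (nth_index j00 jt)) -(nth_map j00 0 d) ?size_t//.
  by apply: (sorted_leq_nth tr _ 0 st); rewrite ?inE ?size_map ?size_t//;
    exact: leq_ltn_trans kj jn.
(* For n = 1 the number [mu 2 A] is the default 0 of [nth], and then there is no such [j]. *)
have le2 j : j != j0 -> d j <= mu 2 A.
  move=> jj0; apply: le_mu; rewrite lt0n; apply: contra_neq jj0 => j_0.
  by rewrite /j0 -j_0 nth_index// mem_sort mem_enum.
exists (e j0); split.
- by have := cdotxx (e j0); rewrite he eqxx => -[].
- rewrite hf (bigD1 j0)//= he eqxx big1 ?addr0 => [|j jj0].
    by rewrite -/(d j0) -mu1 /sqn/= expr1n expr0n addr0 mulr1.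
  by rewrite he (negbTE jj0) /sqn/= expr0n addr0 mulr0.
- by move=> x; rewrite hf hn mulr_sumr; apply: ler_sum => j _;
    apply: ler_wpM2r; [exact: sqn_ge0 | exact: le_mu].
- move=> x; rewrite hf hn (bigD1 j0)//= [in leRHS](bigD1 j0)//= -/(d j0) -mu1.
  set a := sqn _; set T := \sum_(i < n | i != j0) sqn _.
  have -> : mu 1 A * (a + T) - (mu 1 A - mu 2 A) * (a + T - a) =
    mu 1 A * a + mu 2 A * T by ring.
  rewrite lerD2l mulr_sumr; apply: ler_sum => j /le2 dj.
  by apply: ler_wpM2r dj; exact: sqn_ge0.
Qed.

(* The correction term is quadratic in t because moving away from v costs at
   least the spectral gap, which absorbs the cross terms of B. *)
Lemma mu1_perturb n (A : 'M[C]_n) : (0 < n)%N ->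
    A^t* = A -> mu 2 A < mu 1 A ->
  exists v : 'cV[C]_n, [/\ sqnorm v = 1, form A v v = mu 1 A &
    forall B D, B^t* = B -> D^t* = D -> exists K, forall t : R,
      mu 1 (A + t%:C *: B + (t ^+ 2)%:C *: D) <=
    mu 1 A + t * form B v v + K * t ^+ 2].
Proof.
move=> n0 hA gap.
have [v [v1 Av _ hgap]] := herm_gap n0 hA.
(* Subtracting [b] from the diagonal makes the form of [B'] vanish at [v], which isolates the
   first-order change [t * b]. *)
exists v; split=> // B D hB hD; pose b := form B v v; pose B' := B + (- b)%:C *: 1%:M.
pose delta := mu 1 A - mu 2 A.
have delta0 : 0 < delta by rewrite subr_gt0.
pose KB := \sum_i \sum_j sqn (B' i j); pose KD := \sum_i \sum_j sqn (D i j).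
have KB0 : 0 <= KB by do 2 apply: sumr_ge0 => ? _; exact: sqn_ge0.
(* This gives [s^-1 * KB <= 2 * delta]; the [+ 1] keeps [s] positive when [B'] is zero. *)
pose s := (KB + 1) / (2 * delta).
have s0 : 0 < s by rewrite divr_gt0// ?mulr_gt0// ltr_wpDl.
have hB' : B'^t* = B'.
  by rewrite trCD hB trCZ conj_RC trmx1 map_mx1.
exists (2 * s * n%:R + (n%:R + KD) / 2) => t.
set M := A + _ + _.
have hM : M^t* = M by rewrite /M !trCD !trCZ !conj_RC hA hB hD.
(* [u] is a top eigenvector of the perturbed matrix and [w] its projection onto [v]; the squared
   distance between them, [1 - sqn c], is what the gap penalizes. *)
have [u [u1 Mu _ _]] := herm_gap n0 hM.
rewrite -Mu !formD !formZ.
pose c := cdot v u; pose w := c *: v.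
have form_w (E : 'M[C]_n) : form E w w = sqn c * form E v v.
  rewrite /form /w trCZ -scalemxAr -!scalemxAl scalerA mxE [c * _]mulrC.
  by rewrite sqn_conjM ReC_mul.
have form_uw : form 1%:M u w = sqn c.
  rewrite /form mulmx1 /w -scalemxAr mxE.
  have -> : (u^t* *m v) 0 0 = Num.conj c by rewrite -trCE trCM trCK.
  by rewrite mulrC sqn_conjM.
have norm_uw a : sqnorm (u + a%:C *: w) = 1 + (2 * a + a ^+ 2) * sqn c.
  rewrite -form1 formDl !formDr !formZl !formZr !(form_herm w u) ?trmx1 ?map_mx1//.
  by rewrite form_w form_uw !form1 u1 v1; ring.
pose y := u + (- 1)%:C *: w.
have ny : sqnorm y = 1 - sqn c by rewrite norm_uw; ring.
have c1 : sqn c <= 1 by rewrite -subr_ge0 -ny sqnorm_ge0.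
have B'v : form B' v v = 0 by rewrite formD formZ form1 v1 mulr1 subrr.
(* Polarization: the form of [B'] vanishes at [w], so its value at [u] pairs [u + w], of norm at
   most 2, with the small vector [u - w]. *)
have B'u : t * form B' u u = form B' (t%:C *: (u + 1%:C *: w)) y.
  rewrite formZl formDl !formDr !formZl !formZr form_w B'v (form_herm w u)//.
  by ring.
have -> : form B u u = b + form B' u u by rewrite formD formZ form1 u1; ring.
rewrite [t * (_ + _)]mulrDr B'u.
have hA1 := hgap u; rewrite u1 -/c mulr1 -/delta in hA1.
have hB1 := form_le B' (t%:C *: (u + 1%:C *: w)) y s0.
rewrite -/KB ny in hB1.
have hD1 := form_le D u u ltr01.
rewrite -/KD u1 mul1r invr1 mul1r !mulr1 in hD1.
have nt : sqnorm (t%:C *: (u + 1%:C *: w)) <= 4 * t ^+ 2.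
  rewrite -form1 formZl formZr form1 norm_uw.
  have := ler_wpM2l (sqr_ge0 t) c1.
  by rewrite mulr1 expr1n => h; clear - h; lra.
have hs : s^-1 * KB <= 2 * delta.
  rewrite /s invf_div mulrAC ler_pdivrMr ?ltr_wpDl// ler_wpM2l ?lerDl//.
  by rewrite mulr_ge0// ltW.
have hsn : s * n%:R * sqnorm (t%:C *: (u + 1%:C *: w)) <= s * n%:R * (4 * t ^+ 2).
  by rewrite ler_wpM2l// mulr_ge0 ?ler0n// ltW.
have hsy : s^-1 * KB * (1 - sqn c) <= 2 * delta * (1 - sqn c).
  by rewrite ler_wpM2r// subr_ge0.
have hDt : t ^+ 2 * form D u u <= t ^+ 2 * ((n%:R + KD) / 2).
  by rewrite ler_wpM2l ?sqr_ge0//; clear - hD1; lra.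
clear - hA1 hB1 hsn hsy hDt; lra.
Qed.

End complex_forms.

(** * Duality for the relaxation *)

Section psd_matrices.
Variable R : realType.
Notation C := R[i].

(** Diagonalizing B = S^H D S turns the trace into the sum of d_j (S A S^H)_jj, whose factors have
    nonnegative real parts, the d_j being real. *)
Lemma trace_mul_psd_ge0 n (A B : 'M[C]_n) :
  (forall x : 'cV[C]_n, 0 <= form A x x) -> psdC B -> 0 <= complex.Re (\tr (A *m B)).
Proof.
move=> hA [hB B0].
have hH : B \is hermsymmx.
  by apply/is_hermitianmxP; rewrite expr0 scale1r.
have /orthomx_spectralP hS := hermitian_normalmx hH.
set S := spectralmx B in hS; set d := spectral_diag B in hS.
have uS : S \is unitarymx := spectral_unitarymx B.
rewrite invmx_unitary// in hS.
rewrite hS 2!mulmxA mxtrace_mulC !mulmxA mul_mx_diag /mxtrace Re_sum.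
apply: sumr_ge0 => j _; rewrite mxE.
have rowE (X : 'M[C]_n) :
    (row j S *m X *m ((row j S)^t*)) 0 0 = (S *m X *m S^t*) j j.
  by rewrite mxE [RHS]mxE; apply: eq_bigr => k _; rewrite -row_mul !mxE.
have SS : S *m S^t* = 1%:M by apply/unitarymxP.
have hd : 0 <= d 0 j.
  have := B0 ((row j S)^t*); rewrite trCK rowE hS !mulmxA SS mul1mx.
  by rewrite -mulmxA SS mulmx1 mxE eqxx mulr1n.
have /RRe_real <- := ger0_real hd.
have := hA ((row j S)^t*); rewrite /form trCK rowE mulrC ReC_mul => A0.
by rewrite mulr_ge0//; move: hd; rewrite lecE => /andP[].
Qed.

Lemma mx11D (A B : 'M[R]_1) : (A + B) 0 0 = A 0 0 + B 0 0.
Proof. by rewrite mxE. Qed.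

Lemma mx11Z a (A : 'M[R]_1) : (a *: A) 0 0 = a * A 0 0.
Proof. by rewrite mxE. Qed.

Lemma mx11T (A : 'M[R]_1) : A^T 0 0 = A 0 0.
Proof. by rewrite mxE. Qed.

Lemma trmxD m n (A B : 'M[R]_(m, n)) : (A + B)^T = A^T + B^T.
Proof. by apply/matrixP => i j; rewrite !mxE. Qed.

Lemma trmxZ m n a (A : 'M[R]_(m, n)) : (a *: A)^T = a *: A^T.
Proof. by apply/matrixP => i j; rewrite !mxE. Qed.

Lemma mxtrace11 (A : 'M[R]_1) : \tr A = A 0 0.
Proof. by rewrite /mxtrace big_ord1. Qed.

Lemma trace_gram_eq0 m n (A : 'M[R]_(m, n)) : \tr (A^T *m A) <= 0 -> A = 0.
Proof.
move=> A0; have sq k i : 0 <= A i k ^+ 2 by exact: sqr_ge0.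
have E : \tr (A^T *m A) = \sum_k \sum_i A i k ^+ 2.
  by apply: eq_bigr => k _; rewrite mxE; apply: eq_bigr => i _; rewrite mxE.
have : \sum_k \sum_i A i k ^+ 2 == 0.
  by rewrite -E eq_le A0 E sumr_ge0// => k _; apply: sumr_ge0.
rewrite psumr_eq0 => [/allP h|k _]; last exact: sumr_ge0.
apply/matrixP => i k; rewrite mxE; have := h k (mem_index_enum _).
rewrite psumr_eq0//= => /allP/(_ i (mem_index_enum _)).
by rewrite sqrf_eq0 => /eqP.
Qed.

(** Divide by t and let t tend to 0; the explicit t = a / (|K| + 1) replaces the limit. *)
Lemma le0_quadratic (a K : R) :
  (forall t, 0 < t -> t * a <= K * t ^+ 2) -> a <= 0.
Proof.
move=> h; rewrite leNgt; apply/negP => a0.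
have K0 : 0 < `|K| + 1 by rewrite ltr_wpDl.
have t0 : 0 < a / (`|K| + 1) by rewrite divr_gt0.
have := h _ t0; rewrite expr2 mulrCA ler_pM2l// mulrA ler_pdivlMr//.
rewrite mulrC ler_pM2r// leNgt => /negP; apply.
by rewrite (le_lt_trans (ler_norm K))// ltrDl.
Qed.

Lemma block_form n (J : 'M[R]_n) (b u : 'cV[R]_n) (a d : R) :
  ((col_mx u a%:M)^T *m block_mx J b b^T d%:M *m (col_mx u a%:M : 'cV_(n + 1))) 0 0 =
  (u^T *m J *m u) 0 0 + 2 * a * (b^T *m u) 0 0 + a ^+ 2 * d.
Proof.
rewrite tr_col_mx mul_row_block mul_row_col !mulmxDl tr_scalar_mx.
rewrite !mul_scalar_mx !mul_mx_scalar -!scalemxAl !mx11D !mx11Z.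
have -> : (u^T *m b) 0 0 = (b^T *m u) 0 0.
  by rewrite -mx11T trmx_mul trmxK.
rewrite !mxE eqxx !mulr1n; ring.
Qed.

(** The form at (u, a) is the square completed at [u + a *: lam]. Having [lam] with [b = J *m lam]
    takes the place of an inverse of [J], which may be singular. *)
Lemma psdR_block n (J : 'M[R]_n) (lam b : 'cV[R]_n) : J^T = J -> b = J *m lam ->
  (forall x : 'cV[R]_n, 0 <= (x^T *m J *m x) 0 0) ->
  psdR (block_mx J b b^T ((lam^T *m J *m lam) 0 0)%:M : 'M[R]_(n + 1)).
Proof.
move=> hJ bE J0; split.
  by rewrite tr_block_mx hJ trmxK tr_scalar_mx.
move=> x; rewrite -[x]vsubmxK [dsubmx x]mx11_scalar.
move: (usubmx x) (dsubmx x 0 0) => u a; rewrite block_form.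
suff -> : (u^T *m J *m u) 0 0 + 2 * a * (b^T *m u) 0 0 +
    a ^+ 2 * (lam^T *m J *m lam) 0 0 =
    ((u + a *: lam)^T *m J *m (u + a *: lam)) 0 0 by exact: J0.
have -> : b^T *m u = lam^T *m J *m u by rewrite bE trmx_mul hJ.
have sw : (u^T *m J *m lam) 0 0 = (lam^T *m J *m u) 0 0.
  by rewrite -mx11T !trmx_mul trmxK hJ mulmxA.
rewrite trmxD trmxZ !mulmxDl !mulmxDr -!scalemxAl -!scalemxAr.
rewrite !mx11D !mx11Z sw; ring.
Qed.

End psd_matrices.

Section duality.
(* M i j stands for E[Hdot_i^H R_W Hdot_j | Y], and s l for sqrt q_l. The matrix
   JP is arbitrary: it need not be positive semidefinite. *)
Variables (R : realType) (n N : nat).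
Notation C := R[i].
Variable M : 'I_n -> 'I_n -> 'M[C]_N.
Hypothesis hM : forall i j, (M i j)^t* = M j i.
Variables (JP : 'M[R]_n) (s : 'I_n -> R) (P : R).

Definition Pmx (S : 'M[R]_n) : 'M[C]_N := \sum_i \sum_j (S i j)%:C *: M i j.
Definition JDmx (RV : 'M[C]_N) : 'M[R]_n :=
  \matrix_(i, j) (2 * complex.Re (\tr (M j i *m RV))).
Definition dualfun (Lam : 'M[R]_n) : R :=
  2 * \tr (Lam *m diag_mx (\row_l s l)) - \tr (Lam^T *m JP *m Lam)
    - 2 * P * mu 1 (Pmx (Lam *m Lam^T)).

Lemma Pmx_herm S : S^T = S -> (Pmx S)^t* = Pmx S.
Proof.
move=> hS; rewrite /Pmx trC_sum exchange_big; apply: eq_bigr => i _.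
rewrite trC_sum; apply: eq_bigr => j _.
by rewrite trCZ conj_RC hM -[in RHS]hS mxE.
Qed.

Lemma PmxD S T : Pmx (S + T) = Pmx S + Pmx T.
Proof.
rewrite /Pmx -big_split; apply: eq_bigr => i _ /=.
rewrite -big_split; apply: eq_bigr => j _ /=.
by rewrite mxE rmorphD scalerDl.
Qed.

Lemma PmxZ a S : Pmx (a *: S) = a%:C *: Pmx S.
Proof.
rewrite /Pmx scaler_sumr; apply: eq_bigr => i _.
rewrite scaler_sumr; apply: eq_bigr => j _.
by rewrite mxE rmorphM scalerA.
Qed.

(** [Pmx] and [JDmx] are adjoint up to the factor 2, which is the source of the coefficient [2 * P]
    in the dual objective. *)
Lemma trace_JDmx S RV : \tr (S *m JDmx RV) = 2 * complex.Re (\tr (Pmx S *m RV)).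
Proof.
rewrite /Pmx mulmx_suml (raddf_sum (@mxtrace C N)) Re_sum mulr_sumr; apply: eq_bigr => i _ /=.
rewrite mxE mulmx_suml (raddf_sum (@mxtrace C N)) Re_sum mulr_sumr; apply: eq_bigr => j _ /=.
by rewrite !mxE -scalemxAl mxtraceZ ReC_mul; ring.
Qed.

Lemma JDmx_sym RV : RV^t* = RV -> (JDmx RV)^T = JDmx RV.
Proof.
move=> hRV; apply/matrixP => i j; rewrite !mxE; congr (2 * _).
rewrite -[LHS]cRe_conj -[in RHS]hM -[in RHS]hRV -trCM.
rewrite mxtrace_mulC /mxtrace rmorph_sum; congr complex.Re.
by apply: eq_bigr => k _; rewrite trCE.
Qed.

Lemma trace_JDmx_rank1 S (v : 'cV[C]_N) :
  \tr (S *m JDmx (P%:C *: (v *m v^t*))) = 2 * P * form (Pmx S) v v.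
Proof.
rewrite trace_JDmx -scalemxAr mxtraceZ ReC_mul mulrA; congr (_ * _).
by rewrite mulmxA mxtrace_mulC mulmxA /form /mxtrace big_ord1.
Qed.

Definition bim RV := JDmx RV + JP.

Definition lmi RV (d : 'I_n -> R) := forall l, psdR (block_mx
  (bim RV) (s l *: delta_mx l 0) (s l *: delta_mx 0 l) (d l)%:M : 'M[R]_(n + 1)).

Local Notation Q := (diag_mx (\row_l s l)).

Lemma QT : Q^T = Q. Proof. exact: tr_diag_mx. Qed.

Lemma trace_bim (Lam : 'M[R]_n) RV : \tr (Lam^T *m bim RV *m Lam) =
  2 * complex.Re (\tr (Pmx (Lam *m Lam^T) *m RV)) + \tr (Lam^T *m JP *m Lam).
Proof.
rewrite /bim mulmxDr mulmxDl mxtraceD; congr (_ + _).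
by rewrite mxtrace_mulC mulmxA trace_JDmx.
Qed.

(* The trace of RV may be smaller than P, hence the sign condition on mu 1. *)
Lemma weak_duality Lam RV d : (0 < N)%N -> 0 <= mu 1 (Pmx (Lam *m Lam^T)) ->
  lmi RV d -> \tr RV <= P%:C -> psdC RV -> dualfun Lam <= \sum_l d l.
Proof.
move=> N0 mu0 hlmi htr hRV.
have hS : (Lam *m Lam^T)^T = Lam *m Lam^T by rewrite trmx_mul trmxK.
have [v [_ _ hv _]] := herm_gap N0 (Pmx_herm hS).
have h l : 2 * (Lam *m Q) l l <= (Lam^T *m bim RV *m Lam) l l + d l.
  (* The entry -1 makes the border of the block matrix contribute the linear term of the dual
     objective. *)
  have [_ /(_ (col_mx (col l Lam) (-1)%:M))] := hlmi l.
  have -> : s l *: delta_mx 0 l = (s l *: delta_mx l 0 : 'cV[R]_n)^T.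
    by rewrite trmxZ trmx_delta.
  rewrite block_form trmxZ trmx_delta -scalemxAl -rowE mx11Z.
  have -> : ((col l Lam)^T *m bim RV *m col l Lam) 0 0 =
      (Lam^T *m bim RV *m Lam) l l.
    rewrite mxE [RHS]mxE; apply: eq_bigr => i _.
    by rewrite tr_col -row_mul !mxE.
  rewrite mul_mx_diag !mxE sqrrN expr1n mul1r.
  set a := (\sum_j _); set b := Lam l l; lra.
have : 2 * \tr (Lam *m Q) <= \tr (Lam^T *m bim RV *m Lam) + \sum_l d l.
  by rewrite /mxtrace mulr_sumr -big_split; apply: ler_sum => l _; exact: h.
rewrite trace_bim /dualfun.
suff : complex.Re (\tr (Pmx (Lam *m Lam^T) *m RV)) <= P * mu 1 (Pmx (Lam *m Lam^T)).
  move: (mu 1 _) (\tr _) (\tr _) (complex.Re _) (\sum_l _) => a b c e f; lra.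
set m := mu 1 _ in mu0 hv *; set S := Pmx _ in hv *.
(* The form of [m - S] is nonnegative because [m] is the top eigenvalue, so pairing it with [RV]
   bounds tr(S RV) by m tr(RV). *)
have := @trace_mul_psd_ge0 R N (m%:C *: 1%:M + (-1)%:C *: S) RV _ hRV.
rewrite mulmxDl mxtraceD ReD -!scalemxAl !mxtraceZ !ReC_mul mul1mx mulN1r subr_ge0.
move=> hm; apply: (le_trans (hm _)).
  by move=> x; rewrite formD !formZ form1 mulN1r subr_ge0.
rewrite mulrC; apply: ler_wpM2r => //.
by move: htr; rewrite lecE => /andP[].
Qed.

(** * Optimality conditions at a maximizer of the dual *)

Section maximizer.
Variable Lam : 'M[R]_n.
Hypotheses (P0 : 0 < P) (hJP : JP^T = JP).
Hypothesis hmax : forall Lam', dualfun Lam' <= dualfun Lam.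
Let S := Lam *m Lam^T.
Variable v : 'cV[C]_N.
Hypothesis hv : form (Pmx S) v v = mu 1 (Pmx S).
Hypothesis hpert : forall B D, B^t* = B -> D^t* = D -> exists K, forall t : R,
  mu 1 (Pmx S + t%:C *: B + (t ^+ 2)%:C *: D) <=
  mu 1 (Pmx S) + t * form B v v + K * t ^+ 2.

Let RV := P%:C *: (v *m v^t*).

Lemma rank1_herm : RV^t* = RV.
Proof. by rewrite /RV trCZ conj_RC trCM trCK. Qed.

Lemma bim_sym : (bim RV)^T = bim RV.
Proof. by rewrite trmxD hJP JDmx_sym// rank1_herm. Qed.

(** Expand the objective at [Lam + t *: X]: by adjointness the linear term of the mu_1 bound is the
    [JDmx] part of [bim RV], and everything of order t^2 goes into [K]. *)
Lemma dual_perturb X : exists K, forall t,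
  2 * t * \tr (X^T *m (Q - bim RV *m Lam)) <= K * t ^+ 2.
Proof.
pose S1 := Lam *m X^T + X *m Lam^T; pose S2 := X *m X^T.
have hS1 : S1^T = S1 by rewrite trmxD !trmx_mul !trmxK addrC.
have hS2 : S2^T = S2 by rewrite trmx_mul trmxK.
have [K hK] := hpert (Pmx_herm hS1) (Pmx_herm hS2).
exists (\tr (X^T *m JP *m X) + 2 * P * K) => t.
have := hmax (Lam + t *: X); rewrite /dualfun.
have -> : (Lam + t *: X) *m (Lam + t *: X)^T = S + t *: S1 + t ^+ 2 *: S2.
  rewrite trmxD trmxZ mulmxDl !mulmxDr -!scalemxAl -!scalemxAr scalerA.
  by rewrite /S1 scalerDr !addrA expr2.
rewrite !PmxD !PmxZ.
have -> : \tr ((Lam + t *: X) *m Q) = \tr (Lam *m Q) + t * \tr (X *m Q).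
  by rewrite mulmxDl mxtraceD -scalemxAl mxtraceZ.
have trX : \tr (Lam^T *m JP *m X) = \tr (X^T *m JP *m Lam).
  by rewrite -mxtrace_tr !trmx_mul trmxK hJP mulmxA.
have -> : \tr ((Lam + t *: X)^T *m JP *m (Lam + t *: X)) =
    \tr (Lam^T *m JP *m Lam) + 2 * t * \tr (X^T *m JP *m Lam) +
    t ^+ 2 * \tr (X^T *m JP *m X).
  rewrite trmxD trmxZ !mulmxDl !mulmxDr -!scalemxAl -!scalemxAr !mxtraceD.
  rewrite !mxtraceZ trX; ring.
have hf : 2 * P * form (Pmx S1) v v = 2 * \tr (X^T *m JDmx RV *m Lam).
  rewrite -trace_JDmx_rank1 mulmxDl mxtraceD mulr2n mulrDl !mul1r; congr (_ + _).
    by rewrite -mulmxA mxtrace_mulC.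
  rewrite -mxtrace_tr !trmx_mul JDmx_sym ?rank1_herm// trmxK.
  by rewrite mxtrace_mulC -mulmxA mxtrace_mulC.
have -> : \tr (X^T *m (Q - bim RV *m Lam)) =
    \tr (X *m Q) - \tr (X^T *m JP *m Lam) - \tr (X^T *m JDmx RV *m Lam).
  rewrite mulmxBr linearB /= /bim mulmxDl mulmxDr linearD /= !mulmxA opprD addrA addrAC.
  by rewrite -[\tr (X^T *m Q)]mxtrace_tr trmx_mul trmxK QT mxtrace_mulC.
have {hK} hK := ler_wpM2l (ltW (mulr_gt0 (ltr0n R 2) P0)) (hK t).
move: hK; rewrite mulrDr mulrDr [_ * (t * _)]mulrCA hf.
move: (mu 1 _) (mu 1 _) (\tr (X *m Q)) (\tr (Lam *m Q)) (\tr (X^T *m JP *m Lam))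
  (\tr (X^T *m JDmx RV *m Lam)) (\tr (Lam^T *m JP *m Lam)) (\tr (X^T *m JP *m X)).
move=> a b c d e f g h; lra.
Qed.

Lemma stationarity : bim RV *m Lam = Q.
Proof.
(* Taking the residual itself as direction turns the linear term into its squared Frobenius norm. *)
pose G := Q - bim RV *m Lam.
have [K hK] := dual_perturb G.
apply/esym/eqP; rewrite -subr_eq0 -/G; apply/eqP.
apply: trace_gram_eq0; apply: (@le0_quadratic _ _ (K / 2)) => t t0.
by have := hK t; rewrite -/G; move: (\tr _) => a; lra.
Qed.

(* Here Lam *m Lam^T moves by X *m X^T only, so that the constraint expressed by
   the maximality of Lam is one on the quadratic terms. *)
Lemma bim_psd_kernel X : Lam *m X^T = 0 -> 0 <= \tr (X^T *m bim RV *m X).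
Proof.
move=> LX; have XL : X *m Lam^T = 0 by rewrite -[LHS]trmxK trmx_mul trmxK LX trmx0.
pose S2 := X *m X^T.
have hS2 : S2^T = S2 by rewrite trmx_mul trmxK.
have h0 : (0 : 'M[C]_N)^t* = 0 by apply/matrixP => i j; rewrite !mxE rmorph0.
have [K hK] := hpert (Pmx_herm hS2) h0.
rewrite -oppr_le0; apply: (@le0_quadratic _ _ (2 * P * K)) => t t0.
(* The step [Num.sqrt t] makes [Lam *m Lam^T] move linearly in t, so that the direction [S2] is of
   first order. *)
have := hmax (Lam + Num.sqrt t *: X); rewrite /dualfun.
have -> : (Lam + Num.sqrt t *: X) *m (Lam + Num.sqrt t *: X)^T = S + t *: S2.
  rewrite trmxD trmxZ mulmxDl !mulmxDr -!scalemxAl -!scalemxAr scalerA.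
  by rewrite LX XL !scaler0 addr0 add0r -expr2 sqr_sqrtr// ltW.
have -> : \tr ((Lam + Num.sqrt t *: X) *m Q) = \tr (Lam *m Q).
  rewrite mulmxDl mxtraceD -scalemxAl mxtraceZ.
  (* The only term of order [Num.sqrt t] from Q dies: transposed stationarity makes Q a right
     multiple of [Lam^T], and [X *m Lam^T] is 0. *)
  suff -> : \tr (X *m Q) = 0 by rewrite mulr0 addr0.
  by rewrite -QT -stationarity trmx_mul mulmxA XL mul0mx mxtrace0.
have -> : \tr ((Lam + Num.sqrt t *: X)^T *m JP *m (Lam + Num.sqrt t *: X)) =
    \tr (Lam^T *m JP *m Lam) + t * \tr (X^T *m JP *m X).
  rewrite trmxD trmxZ !mulmxDl !mulmxDr -!scalemxAl -!scalemxAr !mxtraceD !mxtraceZ.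
  rewrite mulrA -expr2 sqr_sqrtr ?ltW//.
  rewrite [\tr (X^T *m JP *m Lam)]mxtrace_mulC mulmxA LX mul0mx mxtrace0 mulr0 add0r.
  by rewrite [\tr (Lam^T *m JP *m X)]mxtrace_mulC mulmxA XL mul0mx mxtrace0 mulr0 addr0.
rewrite PmxD PmxZ; have := hK t; rewrite scaler0 addr0 => {}hK.
have {hK} := ler_wpM2l (ltW (mulr_gt0 (ltr0n R 2) P0)) hK.
have -> : \tr (X^T *m bim RV *m X) = 2 * P * form (Pmx S2) v v + \tr (X^T *m JP *m X).
  rewrite /bim mulmxDr mulmxDl mxtraceD -trace_JDmx_rank1 -/RV; congr (_ + _).
  by rewrite mxtrace_mulC mulmxA.
move: (mu 1 _) (mu 1 _) (form _ _ _) (\tr (Lam *m Q)) (\tr (Lam^T *m JP *m Lam))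
  (\tr (X^T *m JP *m X)).
move=> a b c d e f; lra.
Qed.

(* Reflecting the columns of Lam leaves Lam *m Lam^T unchanged, so optimality
   over reflections bounds the linear term of the dualfun objective alone. *)
Lemma bim_psd_range (y : 'cV[R]_n) : 0 <= ((Lam *m y)^T *m bim RV *m (Lam *m y)) 0 0.
Proof.
have -> : (Lam *m y)^T *m bim RV *m (Lam *m y) = y^T *m Q *m (Lam *m y).
  by rewrite trmx_mul -QT -stationarity trmx_mul bim_sym !mulmxA.
have [->|y0] := eqVneq y 0; first by rewrite !mulmx0 mxE.
pose r := (y^T *m y) 0 0.
have r0 : 0 < r.
  rewrite lt_neqAle; apply/andP; split.
    apply: contra_neq y0 => r0; apply: trace_gram_eq0.
    by rewrite mxtrace11 -/r -r0.
  by rewrite /r mxE sumr_ge0// => i _; rewrite mxE -expr2 sqr_ge0.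
(* Householder reflection along [y]: the coefficient makes it orthogonal, and the trace then changes
   by a negative multiple of the quantity to be signed. *)
pose H := 1%:M + (- 2 / r) *: (y *m y^T) : 'M[R]_n.
have HT : H^T = H by rewrite trmxD trmxZ trmx_mul trmxK trmx1.
have HH : H *m H^T = 1%:M.
  rewrite HT /H mulmxDl !mulmxDr mul1mx mulmx1 -!scalemxAl -!scalemxAr mul1mx.
  have -> : y *m y^T *m (y *m y^T) = r *: (y *m y^T).
    rewrite mulmxA -[y *m y^T *m y]mulmxA [y^T *m y]mx11_scalar -/r.
    by rewrite mul_mx_scalar -scalemxAl.
  rewrite !scalerA -addrA -!scalerDl -[RHS]addr0; congr (_ + _).
  rewrite -[RHS](scale0r (y *m y^T)); congr (_ *: _); field.
  by rewrite gt_eqF.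
have := hmax (Lam *m H); rewrite /dualfun.
have -> : Lam *m H *m (Lam *m H)^T = S.
  by rewrite trmx_mul mulmxA -[Lam *m H *m _]mulmxA HH mulmx1.
have -> : \tr ((Lam *m H)^T *m JP *m (Lam *m H)) = \tr (Lam^T *m JP *m Lam).
  rewrite trmx_mul mulmxA mxtrace_mulC !mulmxA HH mul1mx.
  by rewrite -mulmxA.
have -> : \tr (Lam *m H *m Q) =
    \tr (Lam *m Q) - 2 / r * (y^T *m Q *m (Lam *m y)) 0 0.
  rewrite /H mulmxDr mulmxDl mulmx1 mxtraceD -scalemxAr -scalemxAl mxtraceZ.
  rewrite mulNr mulNr; congr (_ - _ * _).
  by rewrite [Lam *m (y *m _)]mulmxA -mulmxA mxtrace_mulC mxtrace11.
rewrite !lerD2r ler_pM2l// gerBl => h.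
by have := mulr_ge0 (ltW r0) h; rewrite mulrA mulrCA divff ?gt_eqF// mulr1 pmulr_rge0.
Qed.

Lemma bim_psd (x : 'cV[R]_n) : 0 <= (x^T *m bim RV *m x) 0 0.
Proof.
have [uL|] := boolP (Lam \in unitmx).
  by rewrite -[x](mulKVmx uL) bim_psd_range.
rewrite -unitmx_tr unitmxE unitfE negbK => /det0P[c c0 cL].
have r0 : 0 < (c *m c^T) 0 0.
  rewrite lt_neqAle; apply/andP; split.
    apply: contra_neq c0 => r0; apply: trmx_inj; rewrite trmx0.
    by apply: trace_gram_eq0; rewrite mxtrace11 trmxK -r0.
  by rewrite mxE sumr_ge0// => i _; rewrite mxE -expr2 sqr_ge0.
have Lc : Lam *m c^T = 0 by rewrite -[LHS]trmxK trmx_mul trmxK cL trmx0.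
(* The direction is admissible for every [x], and its trace form is the squared norm of [c] times
   the form at [x]; a singular [Lam] thus settles all vectors at once. *)
have /bim_psd_kernel : Lam *m (x *m c)^T = 0.
  by rewrite trmx_mul mulmxA Lc mul0mx.
rewrite trmx_mul mxtrace_mulC !mulmxA -[x *m c *m c^T]mulmxA [c *m c^T]mx11_scalar.
rewrite mul_mx_scalar -!scalemxAl mxtraceZ pmulr_rge0//.
by rewrite -mulmxA mxtrace_mulC mxtrace11.
Qed.

Definition dopt l := ((col l Lam)^T *m bim RV *m col l Lam) 0 0.

(** Stationarity says that the border [s l *: delta_mx l 0] is [bim RV] applied to the column l of
    [Lam], the situation of [psdR_block]. *)
Lemma lmi_rank1 : lmi RV dopt.
Proof.
move=> l.
have -> : s l *: delta_mx 0 l = (s l *: delta_mx l 0 : 'cV[R]_n)^T.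
  by rewrite trmxZ trmx_delta.
apply: psdR_block; [exact: bim_sym| |exact: bim_psd].
rewrite [col l Lam]colE mulmxA stationarity -colE.
apply/matrixP => i j; rewrite !mxE ord1 eqxx andbT.
by have [->|] := eqVneq i l; rewrite ?mulr1n ?mulr1// mulr0n mulr0.
Qed.

(** By stationarity tr(Lam^T J Lam) = tr(Lam Q), so 2 tr(Lam Q) - tr(Lam^T J Lam) equals either
    trace. Since [v] attains mu_1, that difference is the dual objective. *)
Lemma sum_dopt : \sum_l dopt l = dualfun Lam.
Proof.
have E : \sum_l dopt l = \tr (Lam^T *m bim RV *m Lam).
  apply: eq_bigr => l _; rewrite /dopt mxE [RHS]mxE; apply: eq_bigr => i _.
  by rewrite tr_col -row_mul !mxE.
have : \tr (Lam^T *m bim RV *m Lam) = \tr (Lam *m Q).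
  by rewrite -mulmxA stationarity -mxtrace_tr trmx_mul trmxK QT mxtrace_mulC.
have : 2 * complex.Re (\tr (Pmx S *m RV)) = 2 * P * mu 1 (Pmx S).
  by rewrite -trace_JDmx trace_JDmx_rank1 hv.
rewrite E trace_bim /dualfun -/S => -> h; rewrite -h; ring.
Qed.

End maximizer.

Theorem rank_one_optimum Lam : 0 < P -> (0 < N)%N -> JP^T = JP ->
    (forall Lam', dualfun Lam' <= dualfun Lam) ->
    0 <= mu 1 (Pmx (Lam *m Lam^T)) ->
    mu 2 (Pmx (Lam *m Lam^T)) < mu 1 (Pmx (Lam *m Lam^T)) ->
  exists RV d, [/\ lmi RV d, \tr RV <= P%:C, psdC RV, (\rank RV <= 1)%N &
    forall RV' d', lmi RV' d' -> \tr RV' <= P%:C -> psdC RV' ->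
      \sum_l d l <= \sum_l d' l].
Proof.
move=> P0 N0 hJP hmax mu0 gap.
have hS : (Lam *m Lam^T)^T = Lam *m Lam^T by rewrite trmx_mul trmxK.
have [v [v1 hv hpert]] := mu1_perturb N0 (Pmx_herm hS) gap.
exists (P%:C *: (v *m v^t*)), (dopt Lam v); split.
- exact: lmi_rank1 hpert.
- rewrite mxtraceZ mxtrace_mulC /mxtrace big_ord1 -/(cdot v v) cdotxx v1.
  by rewrite mulr1.
- split; first exact: rank1_herm.
  move=> x; rewrite -scalemxAr -scalemxAl mxE mulr_ge0//; first by rewrite ler0c ltW.
  rewrite mulmxA -[x^t* *m v *m v^t* *m x]mulmxA.
  rewrite [x^t* *m v]mx11_scalar mul_scalar_mx mxE.
  have -> : (x^t* *m v) 0 0 = Num.conj ((v^t* *m x) 0 0).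
    by rewrite -trCE trCM trCK.
  by rewrite sqn_conjM ler0c sqn_ge0.
- rewrite (leq_trans (mxrank_scale _ _))// (leq_trans (mxrankM_maxl _ _))//.
  exact: rank_leq_col.
- move=> RV' d' h1 h2 h3; rewrite (sum_dopt P0 hJP hmax hv hpert).
  exact: weak_duality h1 h2 h3.
Qed.

End duality.

(** * Integrability with respect to the posterior *)

Section product_integral.
Variable R : realType.
Local Notation lam := (@lebesgue_measure R).

(** Tonelli peels off one coordinate at a time; nonnegativity lets it run before any integrability
    is known. *)
Lemma power_measure_prod_lty n (p : 'I_n -> R -> R) :
  (forall k, measurable_fun [set: R] (p k)) -> (forall k x, 0 <= p k x) ->
  (forall k, (\int[lam]_x (p k x)%:E < +oo)%E) ->
  (\int[power_measure lam n]_t (\prod_k p k (tnth t k))%:E < +oo)%E.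
Proof.
elim: n p => [|n IH] p mp p0 ip.
  under eq_integral do rewrite big_ord0.
  by rewrite /= integral_dirac// diracT mule1 ltry.
have mP : measurable_fun [set: n.-tuple R]
    (fun t => \prod_k p (lift ord0 k) (tnth t k)).
  by apply: measurable_prod => k _; apply: measurableT_comp (mp _) _; exact: measurable_tnth.
have mP1 : measurable_fun [set: n.+1.-tuple R] (fun t => \prod_k p k (tnth t k)).
  by apply: measurable_prod => k _; apply: measurableT_comp (mp _) _; exact: measurable_tnth.
rewrite /= /cons_measure ge0_integral_pushforward//; first last.
- by move=> t _; rewrite lee_fin prodr_ge0.
- exact/measurable_EFinP.
- exact: measurable_cons.
rewrite preimage_setT.
have fE x : ((fun t => (\prod_k p k (tnth t k))%:E) \o
   (fun q : R * n.-tuple R => [the n.+1.-tuple R of q.1 :: q.2])) x =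
   (p ord0 x.1 * \prod_k p (lift ord0 k) (tnth x.2 k))%:E.
  rewrite /= big_ord_recl; congr (_ * _)%:E.
  by apply: eq_bigr => k _; rewrite tnthS.
under eq_integral do rewrite fE.
rewrite fubini_tonelli1; first last.
- by move=> x; rewrite lee_fin mulr_ge0// prodr_ge0.
- apply/measurable_EFinP; apply: measurable_funM.
    by apply: measurableT_comp (mp _) _.
  by apply: measurableT_comp mP _.
pose I := (\int[power_measure lam n]_t
  (\prod_k p (lift ord0 k) (tnth t k))%:E)%E.
have [I0 Ioo] : (0 <= I)%E /\ (I < +oo)%E.
  split; first by apply: integral_ge0 => t _; rewrite lee_fin prodr_ge0.
  by apply: (IH (fun k => p (lift ord0 k))) => k //; exact: ip.
have FI x : fubini_F (power_measure lam n) (fun q : R * n.-tuple R =>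
    (p ord0 q.1 * \prod_k p (lift ord0 k) (tnth q.2 k))%:E) x =
    ((p ord0 x)%:E * I)%E.
  rewrite /fubini_F /=; under eq_integral do rewrite EFinM.
  rewrite ge0_integralZl//.
  - exact/measurable_EFinP.
  - by move=> t _; rewrite lee_fin prodr_ge0.
  - by rewrite lee_fin.
apply: (@le_lt_trans _ _ (\int[lam]_x ((p ord0 x)%:E * I))%E).
  by rewrite le_eqVlt; apply/orP; left; apply/eqP; apply: eq_integral => x _; exact: FI.
have -> : (\int[lam]_x ((p ord0 x)%:E * I) = \int[lam]_x (p ord0 x)%:E * I)%E.
  rewrite -(fineK (_ : I \is a fin_num)) ?ge0_fin_numE//.
  rewrite ge0_integralZr//.
  - by apply/measurable_EFinP; exact: mp.
  - by move=> x _; rewrite lee_fin.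
  - by rewrite lee_fin fine_ge0.
by rewrite lte_mul_pinfty ?ge0_fin_numE ?integral_ge0// => *; rewrite lee_fin.
Qed.

End product_integral.

Section directional.
Variable R : realType.

(** The two difference quotients coincide as functions. The right side is open to the one-variable
    rules of differentiation. *)
Lemma partial_line n (i : 'I_n) (g : 'rV[R]_n -> R) theta :
  partial i g theta = 'D_1 (fun h : R => g (theta + h *: delta_mx 0 i)) 0.
Proof.
rewrite /partial /derive.
set F := (fun h : R => h^-1 *: _).
set G := (fun h : R => h^-1 *: _).
suff -> : F = G by [].
apply/funext => h; rewrite /F /G /= addr0 scale0r addr0 [h *: 1]mulr1.
by rewrite [h *: _ + theta]addrC.
Qed.

Lemma is_derive_phase (D x y z a b c : R) :
  is_derive (0 : R) 1 (fun h : R => (y + h * b) * cos (D * sin (x + h * a)) -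
      (z + h * c) * sin (D * sin (x + h * a)))
    (b * cos (D * sin x) - c * sin (D * sin x) -
     a * D * cos x * (y * sin (D * sin x) + z * cos (D * sin x))).
Proof.
have dl (u w : R) : is_derive (0 : R) 1 (fun h : R => u + h * w) w.
  have -> : (fun h : R => u + h * w) = cst u + (w \*: id).
    by apply/funext => h /=; rewrite -[(_ + _) h]/(u + w * h) mulrC.
  by apply: is_derive_eq; rewrite add0r scaler1.
have dphase : is_derive (0 : R) 1 (fun h : R => D * sin (x + h * a)) (D * (cos x * a)).
  have ds : is_derive (0 : R) 1 (sin \o (fun h : R => x + h * a)) (cos x * a).
    by apply: is_derive1_comp; rewrite mul0r addr0; exact: is_derive_sin.
  have -> : (fun h : R => D * sin (x + h * a)) = D \*: (sin \o (fun h : R => x + h * a)).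
    by apply/funext => h.
  exact: is_deriveZ.
set u := fun h : R => D * sin (x + h * a) in dphase.
have u0 : u 0 = D * sin x by rewrite /u mul0r addr0.
have dc : is_derive (0 : R) 1 (cos \o u) (- sin (D * sin x) * (D * (cos x * a))).
  by apply: is_derive1_comp; rewrite u0; exact: is_derive_cos.
have dn : is_derive (0 : R) 1 (sin \o u) (cos (D * sin x) * (D * (cos x * a))).
  by apply: is_derive1_comp; rewrite u0; exact: is_derive_sin.
have -> : (fun h : R => (y + h * b) * cos (D * sin (x + h * a)) -
      (z + h * c) * sin (D * sin (x + h * a))) =
   (fun h : R => y + h * b) * (cos \o u) - (fun h : R => z + h * c) * (sin \o u).
  by apply/funext => h.
apply: is_derive_eq; rewrite /= u0 !mul0r !addr0 /GRing.scale /=; ring.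
Qed.

End directional.

Section moments.
Variable R : realType.
Local Notation lam := (@lebesgue_measure R).

Lemma dominated_integral_lty (f g : R -> R) (K : R) :
  measurable_fun [set: R] f -> lam.-integrable [set: R] (EFin \o g) ->
  (forall x, 0 <= f x) -> (forall x, f x <= K * g x) ->
  (\int[lam]_x (f x)%:E < +oo)%E.
Proof.
move=> mf ig f0 fg.
have iKg : lam.-integrable [set: R] (fun x => K%:E * (EFin \o g) x)%E.
  by apply: integrableZl.
have : lam.-integrable [set: R] (EFin \o f).
  apply: le_integrable iKg => //; first exact/measurable_EFinP.
  move=> x _ /=; rewrite lee_fin !ger0_norm//.
  exact: le_trans (f0 x) (fg x).
by move=> /integrableP[_]; under eq_integral do rewrite /= ger0_norm//.
Qed.

Let measurable_weight : measurable_fun [set: R] (fun x : R => (1 + `|x|) ^+ 2).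
Proof. by apply: measurable_funX; apply: measurable_funD. Qed.

Lemma normal_moment : (\int[lam]_x
  ((1 + `|x|) ^+ 2 * normal_pdf 0 (Num.sqrt 2^-1) x)%:E < +oo)%E.
Proof.
pose s : R := Num.sqrt 2^-1.
have s0 : s != 0 by rewrite gt_eqF// sqrtr_gt0 invr_gt0 ltr0n.
have n0 : @normal_peak R 1 != 0 by rewrite gt_eqF// normal_peak_gt0// oner_neq0.
(* Comparison with the wider standard normal: variance 1/2 gives exp(-x^2), and the spare factor
   exp(-x^2/2) absorbs the weight, as (1 + |x|)^2 <= 4 (1 + x^2/2) <= 4 exp(x^2/2). *)
apply: (@dominated_integral_lty _ (normal_pdf 0 1) (4 * normal_peak s / normal_peak 1)).
- by apply: measurable_funM => //; exact: measurable_normal_pdf.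
- exact: integrable_normal_pdf.
- by move=> x; rewrite mulr_ge0 ?sqr_ge0// normal_pdf_ge0.
move=> x; rewrite !normal_pdfE ?oner_neq0// /normal_fun !subr0 expr1n.
rewrite sqr_sqrtr ?invr_ge0 ?ler0n// -[2^-1 *+ 2]mulr_natr mulVf ?pnatr_eq0// divr1.
have -> : 4 * normal_peak s / normal_peak 1 *
    (normal_peak 1 * expR (- x ^+ 2 / 2)) =
    normal_peak s * (4 * expR (- x ^+ 2 / 2)) by field.
rewrite mulrCA; apply: ler_wpM2l; first exact: normal_peak_ge0.
have -> : - x ^+ 2 / 2 = - x ^+ 2 + x ^+ 2 / 2 by field.
rewrite expRD mulrCA [leLHS]mulrC; apply: ler_wpM2l; first exact: expR_ge0.
apply: (@le_trans _ _ (4 * (1 + x ^+ 2 / 2))).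
  rewrite -[x ^+ 2]real_normK ?num_real//; have := sqr_ge0 (`|x| - 1).
  by rewrite sqrrB expr1n mulr1 sqrrD expr1n mul1r; clear; lra.
by apply: ler_wpM2l; [rewrite ler0n|exact: expR_ge1Dx].
Qed.

Lemma uniform_moment (a b : R) : a < b -> (\int[lam]_x
  ((1 + `|x|) ^+ 2 * uniform_pdf a b x)%:E < +oo)%E.
Proof.
move=> ab.
(* On the support, |x| is at most |a| + |b|. *)
apply: (@dominated_integral_lty _ (uniform_pdf a b) ((1 + (`|a| + `|b|)) ^+ 2)).
- by apply: measurable_funM => //; exact: measurable_uniform_pdf.
- exact: integrable_uniform_pdf.
- by move=> x; rewrite mulr_ge0 ?sqr_ge0// uniform_pdf_ge0.
move=> x; have := uniform_pdf_ge0 x ab; rewrite /uniform_pdf.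
case: ifPn => [/andP[ax xb] u0|]; last by rewrite !mulr0.
apply: ler_wpM2r => //; rewrite lerXn2r ?nnegrE ?addr_ge0// lerD2l.
rewrite ler_norml; apply/andP; split.
  have := ler_norm (- a); rewrite normrN; have := normr_ge0 b.
  by move: ax; clear; lra.
by rewrite (le_trans xb)// (le_trans (ler_norm b))// lerDr.
Qed.

End moments.

Section tuple_functions.
Variables (R : realType) (n : nat).
Implicit Types g u : 'rV[R]_n -> R.

(** Parameters are row vectors but [power_measure] lives on tuples, so measurability is stated after
    the conversion. *)
Definition tmeas g := measurable_fun [set: n.-tuple R] (fun t => g (\row_i tnth t i)).

Lemma tmeas_ext g u : g =1 u -> tmeas g -> tmeas u.
Proof. by move=> /funext ->. Qed.

Lemma tmeas_cst a : tmeas (fun=> a).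
Proof. exact: measurable_cst. Qed.

Lemma tmeas_coord k : tmeas (fun theta => theta 0 k).
Proof.
rewrite /tmeas; under eq_fun do rewrite mxE.
exact: measurable_tnth.
Qed.

Lemma tmeasD g u : tmeas g -> tmeas u -> tmeas (fun theta => g theta + u theta).
Proof. exact: measurable_funD. Qed.

Lemma tmeasN g : tmeas g -> tmeas (fun theta => - g theta).
Proof. by move=> mg; apply: measurableT_comp. Qed.

Lemma tmeasB g u : tmeas g -> tmeas u -> tmeas (fun theta => g theta - u theta).
Proof. exact: measurable_funB. Qed.

Lemma tmeasM g u : tmeas g -> tmeas u -> tmeas (fun theta => g theta * u theta).
Proof. exact: measurable_funM. Qed.

Lemma tmeas_sum (I : Type) (r : seq I) (G : I -> 'rV[R]_n -> R) :
  (forall i, tmeas (G i)) -> tmeas (fun theta => \sum_(i <- r) G i theta).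
Proof. by move=> h; apply: measurable_sum => i; exact: h. Qed.

Lemma tmeas_prod (I : eqType) (r : seq I) (G : I -> 'rV[R]_n -> R) :
  (forall i, tmeas (G i)) -> tmeas (fun theta => \prod_(i <- r) G i theta).
Proof. by move=> h; apply: measurable_prod => i _; exact: h. Qed.

Lemma tmeas_comp (h : R -> R) g : measurable_fun [set: R] h -> tmeas g ->
  tmeas (fun theta => h (g theta)).
Proof. by move=> mh mg; apply: measurableT_comp mg. Qed.

(* Every entry of a derivative of the response is bounded by a multiple of this
   weight, and its square times the prior is still a product of integrable
   functions of one variable. *)
Definition weight (theta : 'rV[R]_n) : R := \prod_k (1 + `|theta 0 k|).

Lemma weight_ge1 theta : 1 <= weight theta.
Proof.
rewrite /weight; elim/big_ind : _ => // [x y x1 y1|k _]; last by rewrite lerDl.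
by rewrite -[leLHS]mulr1 ler_pM.
Qed.

Lemma coord_le_weight (theta : 'rV[R]_n) k : `|theta 0 k| <= weight theta.
Proof.
rewrite /weight (bigD1 k)//= -[leLHS]mulr1 ler_pM//; first by rewrite lerDr.
elim/big_ind : _ => // [x y x1 y1|j _]; last by rewrite lerDl.
by rewrite -[leLHS]mulr1 ler_pM.
Qed.

Definition tame g := tmeas g /\ exists K, forall theta, `|g theta| <= K * weight theta.

Lemma tame_bounded g K : tmeas g -> (forall theta, `|g theta| <= K) -> tame g.
Proof.
move=> mg hg; split=> //; exists K => theta; apply: (le_trans (hg theta)).
have K0 : 0 <= K := le_trans (normr_ge0 _) (hg theta).
by rewrite -[leLHS]mulr1 ler_wpM2l// weight_ge1.
Qed.

Lemma tame_coordM k g K : tmeas g -> (forall theta, `|g theta| <= K) ->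
  tame (fun theta => theta 0 k * g theta).
Proof.
move=> mg hg; split; first by apply: tmeasM => //; exact: tmeas_coord.
exists K => theta; by rewrite normrM mulrC ler_pM// coord_le_weight.
Qed.

Lemma tameD g u : tame g -> tame u -> tame (fun theta => g theta + u theta).
Proof.
move=> [mg [K hK]] [mu [K' hK']]; split; first exact: tmeasD.
exists (K + K') => theta; rewrite mulrDl (le_trans (ler_normD _ _))//.
by rewrite lerD.
Qed.

Lemma tame_sum (I : Type) (r : seq I) (G : I -> 'rV[R]_n -> R) :
  (forall i, tame (G i)) -> tame (fun theta => \sum_(i <- r) G i theta).
Proof.
move=> h; elim: r => [|i r IH].
  under eq_fun do rewrite big_nil.
  by apply: (@tame_bounded _ 0); [exact: tmeas_cst|rewrite normr0].
by under eq_fun do rewrite big_cons; apply: tameD.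
Qed.

(** What the expectations require of a posterior: the product bound matches the product measure, and
    the exponent 2 leaves room for one [weight] from each of two tame factors. *)
Definition dominated_density (f : 'rV[R]_n -> R) := [/\ tmeas f, forall theta, 0 <= f theta &
  exists (K : R) (p : 'I_n -> R -> R),
  [/\ forall k, measurable_fun [set: R] (p k), forall k x, 0 <= p k x,
      forall k, (\int[@lebesgue_measure R]_x ((1 + `|x|) ^+ 2 * p k x)%:E < +oo)%E,
      0 <= K &
      forall theta, f theta <= K * \prod_k p k (theta 0 k)]].

End tuple_functions.

Section expectation.
Variables (R : realType) (L : nat).
Notation C := R[i].
Notation n := (L + (L + L))%N.
Implicit Types g u : 'rV[R]_n -> R.
Variable f : 'rV[R]_n -> R.
Hypothesis hf : dominated_density f.

Local Notation mu := (power_measure (@lebesgue_measure R) n).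

Definition integ g := mu.-integrable [set: n.-tuple R]
  (fun t => (g (\row_i tnth t i) * f (\row_i tnth t i))%:E).

(** Domination by a constant times the product over k of (1 + |x_k|)^2 p_k(x_k), integrable by
    Tonelli. *)
Lemma integ_tame g u : tame g -> tame u -> integ (fun theta => g theta * u theta).
Proof.
move=> [mg [Kg hg]] [mu_ [Ku hu]]; have [mf f0 [K [p [mp p0 ip K0 fp]]]] := hf.
pose r k x : R := (1 + `|x|) ^+ 2 * p k x.
have mr k : measurable_fun [set: R] (r k).
  by apply: measurable_funM => //; apply: measurable_funX; apply: measurable_funD.
have r0 k x : 0 <= r k x by rewrite mulr_ge0// sqr_ge0.
have iP : mu.-integrable [set: n.-tuple R] (fun t => (\prod_k r k (tnth t k))%:E).
  apply/integrableP; split.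
    apply/measurable_EFinP; apply: measurable_prod => k _.
    by apply: measurableT_comp (mr _) _; exact: measurable_tnth.
  have := power_measure_prod_lty mr r0 ip.
  by congr (_ < _)%E; apply: eq_integral => t _; rewrite /= ger0_norm ?prodr_ge0.
have iG : mu.-integrable [set: n.-tuple R] (fun t =>
     (Kg * Ku * K)%:E * (\prod_k r k (tnth t k))%:E)%E.
  by apply: integrableZl.
apply: le_integrable iG => //.
  by apply/measurable_EFinP; exact: (tmeasM (tmeasM mg mu_) mf).
move=> t _; rewrite lee_fin; set theta := \row_i tnth t i.
have -> : \prod_k r k (tnth t k) = weight theta ^+ 2 * \prod_k p k (theta 0 k).
  rewrite /weight -prodrXl -big_split; apply: eq_bigr => k _.
  by rewrite /r /theta mxE.
rewrite [leRHS]ger0_norm; last first.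
  have w0 : 0 < weight theta := lt_le_trans ltr01 (weight_ge1 _).
  have Kg0 : 0 <= Kg by rewrite -(pmulr_lge0 _ w0) (le_trans _ (hg theta)).
  have Ku0 : 0 <= Ku by rewrite -(pmulr_lge0 _ w0) (le_trans _ (hu theta)).
  apply: mulr_ge0; first by rewrite !mulr_ge0.
  by apply: mulr_ge0; [exact: sqr_ge0 | exact: prodr_ge0].
have -> : Kg * Ku * K * (weight theta ^+ 2 * \prod_k p k (theta 0 k)) =
    (Kg * weight theta) * (Ku * weight theta) * (K * \prod_k p k (theta 0 k)) by ring.
rewrite !normrM (ger0_norm (f0 _)).
by rewrite ler_pM ?mulr_ge0// ler_pM.
Qed.

Lemma integD g u : integ g -> integ u -> integ (fun theta => g theta + u theta).
Proof.
move=> ig iu; have := integrableD measurableT ig iu.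
by apply: eq_integrable => // t _; rewrite /= mulrDl EFinD.
Qed.

Lemma integZ a g : integ g -> integ (fun theta => a * g theta).
Proof.
move=> ig; have := integrableZl measurableT a ig.
by apply: eq_integrable => // t _; rewrite -EFinM mulrA.
Qed.

Lemma expectD g u : integ g -> integ u ->
  expect f (fun theta => g theta + u theta) = expect f g + expect f u.
Proof.
move=> ig iu; rewrite /expect /integral_rV -RintegralD//.
by apply: eq_Rintegral => t _; rewrite mulrDl.
Qed.

Lemma expectZ a g : integ g -> expect f (fun theta => a * g theta) = a * expect f g.
Proof.
move=> ig; rewrite /expect /integral_rV -RintegralZl//.
by apply: eq_Rintegral => t _; rewrite mulrA.
Qed.

Lemma expect_ge0 g : (forall theta, 0 <= g theta) -> 0 <= expect f g.
Proof.
move=> g0; have [_ f0 _] := hf.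
by apply: Rintegral_ge0 => t _; rewrite mulr_ge0.
Qed.

Definition cinteg (h : 'rV[R]_n -> C) :=
  integ (fun theta => complex.Re (h theta)) /\ integ (fun theta => complex.Im (h theta)).

Definition cexpect (h : 'rV[R]_n -> C) : C :=
  expect f (fun theta => complex.Re (h theta)) +i*
  expect f (fun theta => complex.Im (h theta)).

Lemma cinteg_ext h h' : h =1 h' -> cinteg h -> cinteg h'.
Proof. by move=> /funext ->. Qed.

Lemma cintegD h h' : cinteg h -> cinteg h' -> cinteg (fun theta => h theta + h' theta).
Proof.
move=> [h1 h2] [h3 h4]; split.
  by under eq_fun do rewrite ReD; exact: integD.
by under eq_fun do rewrite ImD; exact: integD.
Qed.

Lemma cexpectD h h' : cinteg h -> cinteg h' ->
  cexpect (fun theta => h theta + h' theta) = cexpect h + cexpect h'.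
Proof.
move=> [h1 h2] [h3 h4]; rewrite /cexpect.
under eq_fun do rewrite ReD; under [X in _ +i* expect _ X]eq_fun do rewrite ImD.
by rewrite !expectD.
Qed.

Lemma ReM (x y : C) : complex.Re (x * y) =
  complex.Re x * complex.Re y + - complex.Im x * complex.Im y.
Proof. by case: x y => [? ?] [? ?] /=; rewrite mulNr. Qed.

Lemma ImM (x y : C) : complex.Im (x * y) =
  complex.Re x * complex.Im y + complex.Im x * complex.Re y.
Proof. by case: x y => [? ?] [? ?] /=; rewrite mulrC. Qed.

Lemma cintegZ c h : cinteg h -> cinteg (fun theta => c * h theta).
Proof.
move=> [h1 h2]; split.
  by under eq_fun do rewrite ReM; apply: integD; exact: integZ.
by under eq_fun do rewrite ImM; apply: integD; exact: integZ.
Qed.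

Lemma cexpectZ c h : cinteg h -> cexpect (fun theta => c * h theta) = c * cexpect h.
Proof.
move=> [h1 h2]; rewrite /cexpect.
under eq_fun do rewrite ReM; under [X in _ +i* expect _ X]eq_fun do rewrite ImM.
rewrite !expectD ?expectZ//; try exact: integZ.
by case: c => a b; congr Complex; rewrite /= ?mulNr// mulrC.
Qed.

Lemma cexpect_conj h : cinteg h ->
  cexpect (fun theta => Num.conj (h theta)) = Num.conj (cexpect h).
Proof.
move=> [h1 h2]; rewrite /cexpect.
under eq_fun do rewrite cRe_conj.
under [X in _ +i* expect _ X]eq_fun do rewrite cIm_conj -mulN1r.
by rewrite expectZ// mulN1r.
Qed.

Lemma cinteg0 : cinteg (fun=> 0).
Proof.
by split; (apply: eq_integrable (integrable0 _ _) => // t _; rewrite /= mul0r).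
Qed.

Lemma cexpect0 : cexpect (fun=> 0) = 0.
Proof.
have -> : (fun=> 0) = (fun theta : 'rV[R]_n => (0 : C) * 0) by apply/funext => ?; rewrite mulr0.
by rewrite cexpectZ ?mul0r//; exact: cinteg0.
Qed.

Lemma cinteg_sum (I : Type) (r : seq I) (F : I -> 'rV[R]_n -> C) :
  (forall i, cinteg (F i)) -> cinteg (fun theta => \sum_(i <- r) F i theta).
Proof.
move=> h; elim: r => [|i r IH].
  by under eq_fun do rewrite big_nil; exact: cinteg0.
by under eq_fun do rewrite big_cons; exact: cintegD.
Qed.

Lemma cexpect_sum (I : Type) (r : seq I) (F : I -> 'rV[R]_n -> C) :
  (forall i, cinteg (F i)) ->
  cexpect (fun theta => \sum_(i <- r) F i theta) = \sum_(i <- r) cexpect (F i).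
Proof.
move=> h; elim: r => [|i r IH].
  by under eq_fun do rewrite big_nil; rewrite big_nil cexpect0.
under eq_fun do rewrite big_cons; rewrite big_cons cexpectD ?IH//.
exact: cinteg_sum.
Qed.

Definition ctame (h : 'rV[R]_n -> C) :=
  tame (fun theta => complex.Re (h theta)) /\ tame (fun theta => complex.Im (h theta)).

Lemma cinteg_mul_conj h h' : ctame h -> ctame h' ->
  cinteg (fun theta => h theta * Num.conj (h' theta)).
Proof.
move=> [h1 h2] [h3 h4]; split.
  under eq_fun do rewrite ReM cRe_conj cIm_conj mulrNN.
  by apply: integD; exact: integ_tame.
under eq_fun do rewrite ImM cRe_conj cIm_conj mulrN -mulN1r.
apply: integD; last exact: integ_tame.
by apply: integZ; exact: integ_tame.
Qed.

End expectation.

(** * Expected sandwich products *)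

Section matrix_expectation.
Variables (R : realType) (L NT NR MR : nat).
Notation C := R[i].
Notation n := (L + (L + L))%N.
Variable f : 'rV[R]_n -> R.
Hypothesis hf : dominated_density f.

Definition cintegmx p q (A : 'rV[R]_n -> 'M[C]_(p, q)) :=
  forall r s, cinteg f (fun theta => A theta r s).

Lemma expect_mxE p q (A : 'rV[R]_n -> 'M[C]_(p, q)) r s :
  expect_mx f A r s = cexpect f (fun theta => A theta r s).
Proof. by rewrite mxE. Qed.

Lemma cintegmx_mull m p q (B : 'M[C]_(m, p)) (A : 'rV[R]_n -> 'M[C]_(p, q)) :
  cintegmx A -> cintegmx (fun theta => B *m A theta).
Proof.
move=> hA r s; under eq_fun do rewrite mxE.
by apply: cinteg_sum => k; exact: cintegZ.
Qed.

Lemma cintegmx_mulr m p q (B : 'M[C]_(q, m)) (A : 'rV[R]_n -> 'M[C]_(p, q)) :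
  cintegmx A -> cintegmx (fun theta => A theta *m B).
Proof.
move=> hA r s; under eq_fun do rewrite mxE.
by apply: cinteg_sum => k; under eq_fun do rewrite mulrC; exact: cintegZ.
Qed.

Lemma expect_mx_mulr m p q (B : 'M[C]_(q, m)) (A : 'rV[R]_n -> 'M[C]_(p, q)) :
  cintegmx A -> expect_mx f (fun theta => A theta *m B) = expect_mx f A *m B.
Proof.
move=> hA; apply/matrixP => r s; rewrite expect_mxE mxE.
under eq_fun do rewrite mxE.
rewrite cexpect_sum; last first.
  by move=> k; under eq_fun do rewrite mulrC; exact: cintegZ.
apply: eq_bigr => k _; rewrite expect_mxE mulrC -cexpectZ//.
by congr cexpect; apply/funext => theta; rewrite mulrC.
Qed.

Lemma trace_expect_mx p (A : 'rV[R]_n -> 'M[C]_p) :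
  cintegmx A -> \tr (expect_mx f A) = cexpect f (fun theta => \tr (A theta)).
Proof.
move=> hA; rewrite /mxtrace cexpect_sum => [|i]; last exact: hA.
by apply: eq_bigr => i _; rewrite expect_mxE.
Qed.

Lemma cintegmx_sum (I : Type) (r : seq I) p q (F : I -> 'rV[R]_n -> 'M[C]_(p, q)) :
  (forall i, cintegmx (F i)) -> cintegmx (fun theta => \sum_(i <- r) F i theta).
Proof.
move=> h k l; under eq_fun do rewrite summxE.
by apply: cinteg_sum => i; exact: h.
Qed.

Lemma expect_mx_sum (I : Type) (r : seq I) p q (F : I -> 'rV[R]_n -> 'M[C]_(p, q)) :
  (forall i, cintegmx (F i)) ->
  expect_mx f (fun theta => \sum_(i <- r) F i theta) = \sum_(i <- r) expect_mx f (F i).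
Proof.
move=> h; apply/matrixP => k l; rewrite expect_mxE summxE.
under eq_fun do rewrite summxE.
rewrite cexpect_sum => [|i]; last exact: h.
by apply: eq_bigr => i _; rewrite expect_mxE.
Qed.

Lemma cintegmxZ p q c (A : 'rV[R]_n -> 'M[C]_(p, q)) :
  cintegmx A -> cintegmx (fun theta => c *: A theta).
Proof. by move=> h r s; under eq_fun do rewrite mxE; exact: cintegZ. Qed.

Lemma expect_mxZ p q c (A : 'rV[R]_n -> 'M[C]_(p, q)) :
  cintegmx A -> expect_mx f (fun theta => c *: A theta) = c *: expect_mx f A.
Proof.
move=> h; apply/matrixP => r s; rewrite expect_mxE mxE expect_mxE -cexpectZ//.
by congr cexpect; apply/funext => theta; rewrite mxE.
Qed.

Variable H : 'I_n -> 'rV[R]_n -> 'M[C]_(NR, NT).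
Hypothesis hH : forall i r s, ctame (fun theta => H i theta r s).

Definition sandwich (RW : 'M[C]_NR) i j : 'M[C]_NT :=
  expect_mx f (fun theta => (H i theta)^t* *m RW *m H j theta).

(** Each entry is a finite combination of products of an entry of [H] with a conjugated one, that
    is, of two tame functions. *)
Lemma cintegmx_sandwich (X : 'M[C]_NR) i j :
  cintegmx (fun theta => (H i theta)^t* *m X *m H j theta).
Proof.
move=> r s.
apply: (@cinteg_ext _ _ _ (fun theta => \sum_l \sum_k
    X k l * (H j theta l s * Num.conj (H i theta k r)))).
  move=> theta; rewrite mxE; apply: eq_bigr => l _.
  rewrite mxE mulr_suml; apply: eq_bigr => k _ /=.
  by rewrite trCE; ring.
apply: cinteg_sum => l; apply: cinteg_sum => k; apply: cintegZ.
exact: cinteg_mul_conj.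
Qed.

Lemma cintegmx_outer (X : 'M[C]_NT) i j :
  cintegmx (fun theta => H i theta *m X *m (H j theta)^t*).
Proof.
move=> r s.
apply: (@cinteg_ext _ _ _ (fun theta => \sum_l \sum_k
    X k l * (H i theta r k * Num.conj (H j theta s l)))).
  move=> theta; rewrite mxE; apply: eq_bigr => l _.
  rewrite mxE mulr_suml; apply: eq_bigr => k _ /=.
  by rewrite trCE; ring.
apply: cinteg_sum => l; apply: cinteg_sum => k; apply: cintegZ.
exact: cinteg_mul_conj.
Qed.

Lemma sandwich_herm (RW : 'M[C]_NR) i j : RW^t* = RW ->
  (sandwich RW i j)^t* = sandwich RW j i.
Proof.
move=> hRW; apply/matrixP => r s; rewrite trCE.
rewrite [X in Num.conj X]expect_mxE [RHS]expect_mxE.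
rewrite -(cexpect_conj (cintegmx_sandwich RW i j s r)).
congr cexpect; apply/funext => theta.
by rewrite -trCE !trCM trCK hRW mulmxA.
Qed.

(** Cyclicity under the expectation brings [RV] to the far right, where it can be pulled out; this
    swaps the indices. *)
Lemma trace_sandwich (RV : 'M[C]_NT) (RW : 'M[C]_NR) i j :
  \tr (expect_mx f (fun theta => RW *m H i theta *m RV *m (H j theta)^t*)) =
  \tr (sandwich RW j i *m RV).
Proof.
rewrite -expect_mx_mulr; last exact: cintegmx_sandwich.
rewrite !trace_expect_mx.
- by congr cexpect; apply/funext => theta; rewrite mxtrace_mulC !mulmxA.
- by apply: cintegmx_mulr; exact: cintegmx_sandwich.
- have := cintegmx_mull RW (cintegmx_outer RV i j).
  by congr cintegmx; apply/funext => theta; rewrite !mulmxA.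
Qed.

(** [Gdot] for an abstract family [H] of response derivatives. *)
Definition gmx (w : 'cV[C]_NR) theta : 'M[C]_(NT, n) :=
  \matrix_(r, i) ((H i theta)^t* *m w) r 0.

Lemma gmx_sandwich (w : 'cV[C]_NR) (S : 'M[R]_n) theta :
  gmx w theta *m map_mx (real_complex R) S *m (gmx w theta)^t* =
  \sum_i \sum_j (S i j)%:C *: ((H i theta)^t* *m (w *m w^t*) *m H j theta).
Proof.
apply/matrixP => r s.
have gE k t : gmx w theta t k = ((H k theta)^t* *m w) t 0 by rewrite /gmx mxE.
transitivity (\sum_i \sum_j (S i j)%:C *
    (gmx w theta r i * Num.conj (gmx w theta s j))); last first.
  rewrite summxE; apply: eq_bigr => i _; rewrite summxE; apply: eq_bigr => j _.
  rewrite [RHS]mxE !gE -trCE trCM trCK; congr (_ * _).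
  rewrite !mulmxA -[in RHS](mulmxA _ (w^t*)) [RHS]mxE big_ord1.
  by [].
rewrite exchange_big [LHS]mxE; apply: eq_bigr => j _.
rewrite [X in X * _]mxE mulr_suml; apply: eq_bigr => i _ /=.
by rewrite trCE [X in _ * X * _]mxE; ring.
Qed.

(** The outer products of the columns of [U] add up to U U^H, which condenses the sum over receive
    beams into a single weight. *)
Lemma sum_gmx_sandwich (U : 'M[C]_(NR, MR)) (S : 'M[R]_n) :
  \sum_m expect_mx f (fun theta => gmx (col m U) theta *m
    map_mx (real_complex R) S *m (gmx (col m U) theta)^t*) =
  Pmx (sandwich (U *m U^t*)) S.
Proof.
have E m : expect_mx f (fun theta => gmx (col m U) theta *m
      map_mx (real_complex R) S *m (gmx (col m U) theta)^t*) =
    \sum_i \sum_j (S i j)%:C *: sandwich (col m U *m (col m U)^t*) i j.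
  under eq_fun do rewrite gmx_sandwich.
  rewrite expect_mx_sum => [|i]; last first.
    by apply: cintegmx_sum => j; apply: cintegmxZ; exact: cintegmx_sandwich.
  apply: eq_bigr => i _; rewrite expect_mx_sum => [|j]; last first.
    by apply: cintegmxZ; exact: cintegmx_sandwich.
  by apply: eq_bigr => j _; rewrite expect_mxZ//; exact: cintegmx_sandwich.
rewrite (eq_bigr _ (fun m _ => E m)) exchange_big; apply: eq_bigr => i _ /=.
rewrite exchange_big; apply: eq_bigr => j _ /=; rewrite -scaler_sumr; congr (_ *: _).
rewrite /sandwich -expect_mx_sum; last by move=> m; exact: cintegmx_sandwich.
congr expect_mx; apply/funext => theta; rewrite -mulmx_suml -mulmx_sumr.
congr (_ *m _ *m _); apply/matrixP => r s; rewrite summxE mxE.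
by apply: eq_bigr => m _; rewrite mxE big_ord1 !mxE.
Qed.

(** The integrand is a Gram matrix. The bound on its diagonal later gives the sign of mu_1 that weak
    duality requires. *)
Lemma gmx_gram_ge0 (w : 'cV[C]_NR) (Lam : 'M[R]_n) r :
  0 <= complex.Re (expect_mx f (fun theta => gmx w theta *m
    map_mx (real_complex R) (Lam *m Lam^T) *m (gmx w theta)^t*) r r).
Proof.
rewrite mxE /=; apply: (expect_ge0 hf) => theta.
move: (gmx w theta) => G; set Lc := map_mx (real_complex R) Lam.
have -> : map_mx (real_complex R) (Lam *m Lam^T) = Lc *m Lc^t*.
  rewrite map_mxM; congr (_ *m _); apply/matrixP => i j.
  by rewrite trCE !mxE conj_RC.
have -> : G *m (Lc *m Lc^t*) *m G^t* = (G *m Lc) *m (G *m Lc)^t*.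
  by rewrite trCM !mulmxA.
rewrite mxE Re_sum; apply: sumr_ge0 => k _.
by rewrite trCE mulrC sqn_conjM sqn_ge0.
Qed.

End matrix_expectation.

Section model_sandwich.
Variables (R : realType) (L NT NR MR : nat).
Notation C := R[i].
Notation n := (L + (L + L))%N.
Variable f : 'rV[R]_n -> R.
Hypothesis hf : dominated_density f.
Hypothesis hH : forall i r s, ctame (fun theta => @dresponse R L NR NT i theta r s).

Lemma JD_sandwich (RV : 'M[C]_NT) (RW : 'M[C]_NR) :
  JD f RV RW = JDmx (sandwich f (@dresponse R L NR NT) RW) RV.
Proof.
apply/matrixP => i j; rewrite [LHS]mxE [RHS]mxE; congr (2 * complex.Re _).
exact: (trace_sandwich hf hH).
Qed.

Lemma Ptilde_sandwich (U : 'M[C]_(NR, MR)) (S : 'M[R]_n) :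
  Ptilde NT f U S = Pmx (sandwich f (@dresponse R L NR NT) (U *m U^t*)) S.
Proof. exact: (sum_gmx_sandwich hf hH). Qed.

Lemma Ptilde_gram_diag_ge0 (U : 'M[C]_(NR, MR)) (Lam : 'M[R]_n) r :
  0 <= complex.Re (Ptilde NT f U (Lam *m Lam^T) r r).
Proof.
rewrite summxE Re_sum; apply: sumr_ge0 => m _.
exact: (gmx_gram_ge0 hf (@dresponse R L NR NT)).
Qed.

End model_sandwich.

(** * Derivatives of the response and the posterior density *)

Section response_derivatives.
Variables (R : realType) (L : nat).
Notation C := R[i].
Notation n := (L + (L + L))%N.

Lemma measurable_cos : measurable_fun [set: R] (@cos R).
Proof. by apply: continuous_measurable_fun; exact: continuous_cos. Qed.

Lemma measurable_sin : measurable_fun [set: R] (@sin R).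
Proof. by apply: continuous_measurable_fun; exact: continuous_sin. Qed.

Section phase_sum.
Variables (kx ky kz : 'I_L -> 'I_n) (D s : R).

(** Real part of a sum of terms alpha_j exp(i D sin phi_j) when s = 1; the imaginary part when s =
    -1 and [ky], [kz] are exchanged. *)
Definition phase_sum (theta : 'rV[R]_n) : R := \sum_j
  (theta 0 (ky j) * cos (D * sin (theta 0 (kx j))) -
   s * theta 0 (kz j) * sin (D * sin (theta 0 (kx j)))).

Lemma tmeas_phase k : tmeas (fun theta : 'rV[R]_n => D * sin (theta 0 k)).
Proof.
apply: tmeasM; first exact: tmeas_cst.
by apply: (tmeas_comp measurable_sin); exact: tmeas_coord.
Qed.

Lemma tmeas_phase_sum : tmeas phase_sum.
Proof.
apply: tmeas_sum => j; apply: tmeasB; apply: tmeasM.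
- exact: tmeas_coord.
- exact: (tmeas_comp measurable_cos (tmeas_phase _)).
- by apply: tmeasM; [exact: tmeas_cst|exact: tmeas_coord].
- exact: (tmeas_comp measurable_sin (tmeas_phase _)).
Qed.

(** An angle derivative leaves a gain times bounded trigonometric factors, a gain derivative only
    bounded factors; so growth is at most linear. *)
Lemma tame_partial_phase_sum i : tame (partial i phase_sum).
Proof.
pose b k : R := (k == i)%:R.
have -> : partial i phase_sum = fun theta => \sum_j
   ((b (ky j) * cos (D * sin (theta 0 (kx j))) +
     - (s * b (kz j)) * sin (D * sin (theta 0 (kx j)))) +
   (theta 0 (ky j) * (- (b (kx j) * D) * (cos (theta 0 (kx j)) * sin (D * sin (theta 0 (kx j))))) +
    theta 0 (kz j) * (- (b (kx j) * D * s) * (cos (theta 0 (kx j)) * cos (D * sin (theta 0 (kx j))))))).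
  apply/funext => theta; rewrite partial_line.
  pose T j (h : R) := (theta 0 (ky j) + h * b (ky j)) * cos (D * sin (theta 0 (kx j) + h * b (kx j))) -
      (s * theta 0 (kz j) + h * (s * b (kz j))) * sin (D * sin (theta 0 (kx j) + h * b (kx j))).
  have -> : (fun h : R => phase_sum (theta + h *: delta_mx 0 i)) = \sum_(j < L) T j.
    apply/funext => h; rewrite fct_sumE; apply: eq_bigr => j _.
    have co k : (theta + h *: delta_mx 0 i) 0 k = theta 0 k + h * b k.
      by rewrite !mxE.
    by rewrite /T !co mulrDr [s * (h * _)]mulrCA.
  have dT j := is_derive_phase D (theta 0 (kx j)) (theta 0 (ky j)) (s * theta 0 (kz j))
    (b (kx j)) (b (ky j)) (s * b (kz j)).
  have /@derive_val -> := is_derive_sum dT.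
  by apply: eq_bigr => j _; ring.
have bcos (x : R) : `|cos x| <= 1 by rewrite ler_norml cos_geN1 cos_le1.
have bsin (x : R) : `|sin x| <= 1 by rewrite ler_norml sin_geN1 sin_le1.
have bM (m x y : R) : `|x| <= 1 -> `|y| <= 1 -> `|m * (x * y)| <= `|m|.
  by move=> x1 y1; rewrite !normrM ler_piMr// mulr_ile1.
have mc := tmeas_comp measurable_cos (tmeas_phase _).
have ms := tmeas_comp measurable_sin (tmeas_phase _).
have mx k := tmeas_comp measurable_cos (@tmeas_coord R n k).
apply: tame_sum => j; apply: tameD; last apply: tameD.
- apply: (@tame_bounded _ _ _ (`|b (ky j)| + `|s * b (kz j)|)).
    by apply: tmeasD; apply: tmeasM => //; exact: tmeas_cst.
  move=> theta; rewrite (le_trans (ler_normD _ _))// !normrM normrN normrM.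
  by rewrite lerD// ler_piMr// mulr_ge0.
- apply: (@tame_coordM _ _ _ _ `|- (b (kx j) * D)|).
    apply: tmeasM; first exact: tmeas_cst.
    by apply: tmeasM.
  by move=> theta; exact: bM.
- apply: (@tame_coordM _ _ _ _ `|- (b (kx j) * D * s)|).
    apply: tmeasM; first exact: tmeas_cst.
    by apply: tmeasM.
  by move=> theta; exact: bM.
Qed.

End phase_sum.

Let kphi (j : 'I_L) : 'I_n := lshift (L + L) j.
Let kre (j : 'I_L) : 'I_n := rshift L (lshift L j).
Let kim (j : 'I_L) : 'I_n := rshift L (rshift L j).

Variables NR NT : nat.

Lemma response_phase_sum (r : 'I_NR) (c : 'I_NT) :
  (fun theta => complex.Re (response NR NT theta r c)) =
    phase_sum kphi kre kim (r%:R * pi - c%:R * pi) 1 /\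
  (fun theta => complex.Im (response NR NT theta r c)) =
    phase_sum kphi kim kre (r%:R * pi - c%:R * pi) (-1).
Proof.
have E theta : response NR NT theta r c = \sum_j
    (theta 0 (kre j) +i* theta 0 (kim j)) *
    (cos ((r%:R * pi - c%:R * pi) * sin (theta 0 (kphi j))) +i*
     sin ((r%:R * pi - c%:R * pi) * sin (theta 0 (kphi j)))).
  rewrite /response summxE; apply: eq_bigr => j _.
  rewrite mxE; congr (_ * _).
    by rewrite /alpha_re /alpha_im !mxE.
  rewrite mxE big_ord1 trCE !mxE /phi !mxE -/(kphi j) mulrBl cosB sinB.
  by rewrite /Num.conj /=; congr Complex; rewrite /=; ring.
split; apply/funext => theta; rewrite E.
  by rewrite Re_sum; apply: eq_bigr => j _; rewrite mul1r.
rewrite (big_morph _ (@ImD R) (erefl _)); apply: eq_bigr => j _ /=; ring.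
Qed.

Lemma ctame_dresponse i r c : ctame (fun theta => @dresponse R L NR NT i theta r c).
Proof.
have [ER EI] := response_phase_sum r c.
split.
  have -> : (fun theta => complex.Re (@dresponse R L NR NT i theta r c)) =
      partial i (fun theta => complex.Re (response NR NT theta r c)).
    by apply/funext => theta; rewrite /dresponse mxE.
  by rewrite ER; exact: tame_partial_phase_sum.
have -> : (fun theta => complex.Im (@dresponse R L NR NT i theta r c)) =
    partial i (fun theta => complex.Im (response NR NT theta r c)).
  by apply/funext => theta; rewrite /dresponse mxE.
by rewrite EI; exact: tame_partial_phase_sum.
Qed.

End response_derivatives.

(** * Gram matrices, for bounds on the likelihood *)

Section gram.
Variable R : realType.
Notation C := R[i].

Lemma trace_gram_ge0 m n (A : 'M[C]_(m, n)) : 0 <= complex.Re (\tr (A^t* *m A)).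
Proof.
rewrite /mxtrace Re_sum; apply: sumr_ge0 => k _; rewrite mxE Re_sum.
by apply: sumr_ge0 => i _; rewrite trCE sqn_conjM sqn_ge0.
Qed.

Lemma gram_herm m n (A : 'M[C]_(m, n)) : (A^t* *m A)^t* = A^t* *m A.
Proof. by rewrite trCM trCK. Qed.

(** With K = A^H A one has K^-1 = (A K^-1)^H (A K^-1), so the trace is a squared Frobenius norm.
    This makes the exponent of [obs_pdf] nonpositive. *)
Lemma trace_inv_gram_ge0 m n p (A : 'M[C]_(m, n)) (B : 'M[C]_(n, p)) :
  A^t* *m A \in unitmx -> 0 <= complex.Re (\tr (B^t* *m invmx (A^t* *m A) *m B)).
Proof.
move=> uK; set K := A^t* *m A in uK *.
have hKV : (invmx K)^t* = invmx K.
  rewrite -[RHS]mulmx1 -[LHS]mul1mx -[X in X *m _](mulVmx uK) -mulmxA; congr (_ *m _).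
  by rewrite -[X in X *m _](gram_herm A) -/K -trCM mulVmx// trmx1 map_mx1.
have -> : B^t* *m invmx K *m B = (A *m invmx K *m B)^t* *m (A *m invmx K *m B).
  rewrite !trCM hKV !mulmxA -[_ *m A^t* *m A]mulmxA -/K.
  by rewrite mulmxKV.
exact: trace_gram_ge0.
Qed.

(** The eigenvalues are squared column norms of A S^H, where [S] is the unitary diagonalizing
    matrix. *)
Lemma det_gram_ge0 m n (A : 'M[C]_(m, n)) : 0 <= complex.Re (\det (A^t* *m A)).
Proof.
set K := A^t* *m A.
have hH : K \is hermsymmx.
  by apply/is_hermitianmxP; rewrite expr0 scale1r /K gram_herm.
have /orthomx_spectralP hS := hermitian_normalmx hH.
set S := spectralmx K in hS; set d := spectral_diag K in hS.
have uS : S \is unitarymx := spectral_unitarymx K.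
have SS : S *m S^t* = 1%:M by apply/unitarymxP.
have dE : diag_mx d = (A *m S^t*)^t* *m (A *m S^t*).
  rewrite trCM trCK -mulmxA [A^t* *m _]mulmxA -/K hS invmx_unitary// !mulmxA SS mul1mx.
  by rewrite -mulmxA SS mulmx1.
have d0 j : 0 <= d 0 j.
  have -> : d 0 j = diag_mx d j j by rewrite mxE eqxx mulr1n.
  rewrite dE mxE; apply: sumr_ge0 => i _.
  by rewrite trCE sqn_conjM ler0c sqn_ge0.
have : 0 <= \det K.
  rewrite hS !det_mulmx det_inv mulrAC mulVf ?mul1r; last first.
    by rewrite -unitfE -unitmxE unitarymx_unit.
  by rewrite det_diag; apply: prodr_ge0.
by rewrite lecE => /andP[].
Qed.

End gram.

(** * Domination of the posterior density *)

Section posterior_density.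
Variables (R : realType) (L : nat).
Notation C := R[i].
Notation n := (L + (L + L))%N.

Definition cmeas (h : 'rV[R]_n -> C) :=
  tmeas (fun theta => complex.Re (h theta)) /\ tmeas (fun theta => complex.Im (h theta)).

Lemma cmeas_ext h h' : h =1 h' -> cmeas h -> cmeas h'.
Proof. by move=> /funext ->. Qed.

Lemma cmeas_cst c : cmeas (fun=> c).
Proof. by split; exact: tmeas_cst. Qed.

Lemma cmeasB h h' : cmeas h -> cmeas h' -> cmeas (fun theta => h theta - h' theta).
Proof.
move=> [h1 h2] [h3 h4]; split.
  apply: tmeas_ext (tmeasB h1 h3) => theta; by rewrite ReD ReN.
apply: tmeas_ext (tmeasB h2 h4) => theta.
by rewrite ImD; case: (h' theta).
Qed.

Lemma cmeasM h h' : cmeas h -> cmeas h' -> cmeas (fun theta => h theta * h' theta).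
Proof.
move=> [h1 h2] [h3 h4]; split.
  by apply: tmeas_ext (tmeasB (tmeasM h1 h3) (tmeasM h2 h4)) => theta; rewrite ReM mulNr.
by apply: tmeas_ext (tmeasD (tmeasM h1 h4) (tmeasM h2 h3)) => theta; rewrite ImM.
Qed.

Lemma cmeas_conj h : cmeas h -> cmeas (fun theta => Num.conj (h theta)).
Proof.
move=> [h1 h2]; split; first by apply: tmeas_ext h1 => theta; rewrite cRe_conj.
by apply: tmeas_ext (tmeasN h2) => theta; rewrite cIm_conj.
Qed.

Lemma cmeas_sum (I : Type) (r : seq I) (F : I -> 'rV[R]_n -> C) :
  (forall i, cmeas (F i)) -> cmeas (fun theta => \sum_(i <- r) F i theta).
Proof.
move=> h; split.
  apply: (@tmeas_ext _ _ (fun theta => \sum_(i <- r) complex.Re (F i theta))) => [theta|].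
    by rewrite Re_sum.
  by apply: tmeas_sum => i; have [] := h i.
apply: (@tmeas_ext _ _ (fun theta => \sum_(i <- r) complex.Im (F i theta))) => [theta|].
  by rewrite (big_morph _ (@ImD R) (erefl _)).
by apply: tmeas_sum => i; have [] := h i.
Qed.

Definition cmeasmx p q (A : 'rV[R]_n -> 'M[C]_(p, q)) :=
  forall r s, cmeas (fun theta => A theta r s).

Lemma cmeasmx_cst p q (A : 'M[C]_(p, q)) : cmeasmx (fun=> A).
Proof. by move=> r s; exact: cmeas_cst. Qed.

Lemma cmeasmxM p q m (A : 'rV[R]_n -> 'M[C]_(p, q)) (B : 'rV[R]_n -> 'M[C]_(q, m)) :
  cmeasmx A -> cmeasmx B -> cmeasmx (fun theta => A theta *m B theta).
Proof.
move=> hA hB r s; under eq_fun do rewrite mxE.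
by apply: cmeas_sum => k; exact: cmeasM.
Qed.

Lemma cmeasmx_trC p q (A : 'rV[R]_n -> 'M[C]_(p, q)) :
  cmeasmx A -> cmeasmx (fun theta => (A theta)^t*).
Proof. by move=> hA r s; under eq_fun do rewrite trCE; exact: cmeas_conj. Qed.

Lemma cmeasmx_response NR NT : cmeasmx (@response R L NR NT).
Proof.
move=> r c; have [ER EI] := @response_phase_sum R L NR NT r c.
by split; rewrite ?ER ?EI; exact: tmeas_phase_sum.
Qed.

Section observation.
Variables (NT NR MT MR : nat) (v : 'M[C]_(NT, MT)) (w : 'M[C]_(NR, MR)).
Variable y : 'M[C]_(MR, MT).

Lemma tmeas_obs_pdf : tmeas (obs_pdf (L := L) v w y).
Proof.
apply: tmeasM; last exact: tmeas_cst.
apply: (tmeas_comp (@measurable_expR R)).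
pose e (theta : 'rV[R]_n) := y - w^t* *m response NR NT theta *m v.
have me : cmeasmx e.
  move=> r s; apply: (@cmeas_ext (fun theta =>
      y r s - (w^t* *m response NR NT theta *m v) r s)) => [theta|].
    by rewrite /e [RHS]mxE [in RHS]mxE.
  apply: cmeasB; first exact: cmeas_cst.
  apply: cmeasmxM; last exact: cmeasmx_cst.
  by apply: cmeasmxM; [exact: cmeasmx_cst|exact: cmeasmx_response].
have mt : cmeas (fun theta => \tr ((e theta)^t* *m invmx (w^t* *m w) *m e theta)).
  apply: cmeas_sum => k; apply: (cmeasmxM _ me).
  by apply: cmeasmxM; [exact: cmeasmx_trC|exact: cmeasmx_cst].
have [mre _] := mt.
exact: tmeasN.
Qed.

Hypothesis uw : w^t* *m w \in unitmx.

Lemma obs_pdf_bound : exists K, forall theta, 0 <= obs_pdf (L := L) v w y theta <= K.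
Proof.
pose c : R := (pi ^+ (MR * MT) * complex.Re (\det (w^t* *m w)) ^+ MT)^-1.
have c0 : 0 <= c.
  by rewrite invr_ge0 mulr_ge0 ?exprn_ge0 ?pi_ge0 ?det_gram_ge0.
exists c => theta; rewrite /obs_pdf -/c mulr_ge0 ?expR_ge0//=.
by rewrite ler_piMl// -expR0 ler_expR oppr_le0 trace_inv_gram_ge0.
Qed.

End observation.

Lemma prod_bounded (I : Type) (r : seq I) (G : I -> 'rV[R]_n -> R) :
  (forall i, exists K, forall theta, 0 <= G i theta <= K) ->
  exists K, forall theta, 0 <= \prod_(i <- r) G i theta <= K.
Proof.
move=> h; elim: r => [|i r [K IH]].
  by exists 1 => theta; rewrite big_nil ler01 lexx.
have [K' hK'] := h i; exists (K' * K) => theta; rewrite big_cons.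
have /andP[? ?] := hK' theta; have /andP[? ?] := IH theta.
by rewrite mulr_ge0//= ler_pM.
Qed.

Definition prior_factor (phimin phimax : R) (k : 'I_n) : R -> R :=
  if fintype.split k is inl _ then uniform_pdf phimin phimax
  else normal_pdf 0 (Num.sqrt 2^-1).

(** Regroups the prior by coordinate instead of by path, the shape that [dominated_density] asks
    for. *)
Lemma prior_pdfE phimin phimax (theta : 'rV[R]_n) :
  prior_pdf phimin phimax theta = \prod_k prior_factor phimin phimax k (theta 0 k).
Proof.
rewrite [RHS]big_split_ord [X in _ = _ * X]big_split_ord /=.
rewrite /prior_pdf big_split big_split /=; congr (_ * (_ * _));
  apply: eq_bigr => j _; rewrite /prior_factor.
- by rewrite (unsplitK (inl j)) /phi mxE.
- by rewrite (unsplitK (inr (lshift L j))) /alpha_re !mxE.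
- by rewrite (unsplitK (inr (rshift L j))) /alpha_im !mxE.
Qed.

Section posterior.
Variables (NT NR MT MR : nat) (phimin phimax : R) (hphi : phimin < phimax).
Variables (V : seq 'M[C]_(MR, MT) -> 'M[C]_(NT, MT)).
Variables (W : seq 'M[C]_(MR, MT) -> 'M[C]_(NR, MR)).
Hypothesis hW : forall s, (W s)^t* *m W s \in unitmx.
Variables (m : nat) (Y : m.-tuple 'M[C]_(MR, MT)).

Lemma posterior_dominated : dominated_density (posterior_pdf (L := L) phimin phimax V W Y).
Proof.
pose p := prior_factor phimin phimax.
have mp k : measurable_fun [set: R] (p k).
  rewrite /p /prior_factor; case: fintype.split => _; first exact: measurable_uniform_pdf.
  exact: measurable_normal_pdf.
have p0 k x : 0 <= p k x.
  rewrite /p /prior_factor; case: fintype.split => _; first exact: uniform_pdf_ge0.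
  exact: normal_pdf_ge0.
have [K hK] : exists K, forall theta, 0 <= likelihood (L := L) V W Y theta <= K.
  by apply: prod_bounded => l; exact: obs_pdf_bound.
have K0 : 0 <= K by have /andP[a b] := hK 0; exact: le_trans b.
have prior0 (theta : 'rV[R]_n) : 0 <= prior_pdf phimin phimax theta.
  by rewrite prior_pdfE prodr_ge0.
have joint0 (theta : 'rV[R]_n) : 0 <= joint_pdf phimin phimax V W Y theta.
  by rewrite mulr_ge0//; have /andP[] := hK theta.
pose Z := integral_rV (joint_pdf (L := L) phimin phimax V W Y).
(* This covers a vanishing [Z] too, the inverse of 0 being 0. *)
have Z0 : 0 <= Z^-1 by rewrite invr_ge0; apply: Rintegral_ge0 => t _.
split.
- apply: tmeasM; last exact: tmeas_cst.
  apply: tmeasM; last by apply: tmeas_prod => l; exact: tmeas_obs_pdf.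
  have -> : prior_pdf phimin phimax = fun theta : 'rV[R]_n => \prod_k p k (theta 0 k).
    by apply/funext => theta; rewrite prior_pdfE.
  by apply: tmeas_prod => k; apply: (tmeas_comp (mp k)); exact: tmeas_coord.
- by move=> theta; rewrite mulr_ge0.
exists (K * Z^-1), p; split=> //.
- move=> k; rewrite /p /prior_factor; case: fintype.split => _; first exact: uniform_moment.
  exact: normal_moment.
- by rewrite mulr_ge0.
move=> theta; rewrite /posterior_pdf -/Z /joint_pdf prior_pdfE [leRHS]mulrAC ler_wpM2r//.
by rewrite mulrC ler_wpM2r ?prodr_ge0//; have /andP[] := hK theta.
Qed.

End posterior.

End posterior_density.

(** * Range projectors and the tightness theorem *)

Section range.
Variable R : realType.
Notation C := R[i].

(** The projector depends on the range only. This ties [Ptilde], built from the orthonormal [U], to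
    the information matrix, built from [W]. *)
Lemma proj_range_orthonormal m p (U : 'M[C]_(m, p)) (T : 'M[C]_p) :
  U^t* *m U = 1%:M -> T \in unitmx -> proj_range (U *m T) = U *m U^t*.
Proof.
move=> hU uT; rewrite /proj_range trCM.
have -> : T^t* *m U^t* *m (U *m T) = T^t* *m T.
  by rewrite mulmxA -[_ *m U^t* *m U]mulmxA hU mulmx1.
have uTt : T^t* \in unitmx by rewrite map_unitmx unitmx_tr.
have -> : invmx (T^t* *m T) = invmx T *m invmx (T^t*).
  apply: (@can_inj _ _ (mulmx (T^t* *m T)) (mulmx (invmx (T^t* *m T)))).
    by apply: mulKmx; rewrite unitmx_mul uTt.
  rewrite mulmxV ?unitmx_mul ?uTt// mulmxA -[_ *m T *m invmx T]mulmxA mulmxV//.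
  by rewrite mulmx1 mulmxV.
rewrite !mulmxA -[U *m T *m invmx T]mulmxA mulmxV// mulmx1.
by rewrite -[U *m _ *m _]mulmxA mulVmx// mulmx1.
Qed.

End range.

Theorem corollary4 (R : realType) (L MT NT MR NR : nat)
  (hL : (1 <= L)%N) (hMT : (1 <= MT)%N) (hNT : (MT < NT)%N)
  (hMR : (1 <= MR)%N) (hNR : (MR < NR)%N)
  (P : R) (hP : 0 < P)
  (q : 'I_(L + (L + L)) -> R) (hq : forall l, 0 <= q l) (hq1 : \sum_l q l = 1)
  (phimin phimax : R) (hphi : phimin < phimax)
  (k : nat) (hk : (1 <= k)%N)
  (Vpast : seq 'M[R[i]]_(MR, MT) -> 'M[R[i]]_(NT, MT))
  (Wpast : seq 'M[R[i]]_(MR, MT) -> 'M[R[i]]_(NR, MR))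
  (hWpast : forall s, (Wpast s)^t* *m Wpast s \in unitmx)
  (Y : k.-1.-tuple 'M[R[i]]_(MR, MT)) :
  let f := posterior_pdf (L := L) phimin phimax Vpast Wpast Y in
  (exists (V : 'M[R[i]]_(NT, MT)) (W : 'M[R[i]]_(NR, MR)),
     W^t* *m W \in unitmx /\ J f (V *m V^t*) (proj_range W) \in unitmx) ->
  forall (W : 'M[R[i]]_(NR, MR)) (hW : W^t* *m W \in unitmx)
    (U : 'M[R[i]]_(NR, MR)) (hU : U^t* *m U = 1%:M)
    (hUW : exists2 T : 'M[R[i]]_MR, T \in unitmx & W = U *m T)
    (Lam : 'M[R]_(L + (L + L)))
    (hLam : forall Lam' : 'M[R]_(L + (L + L)),
        dual_objective NT f P q U Lam' <= dual_objective NT f P q U Lam),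
  mu 2 (Ptilde NT f U (Lam *m Lam^T)) < mu 1 (Ptilde NT f U (Lam *m Lam^T)) ->
  optimal_value (sdr_feasible (NT := NT) f P q (proj_range W)) =
  optimal_value (rank_feasible (NT := NT) f P q MT (proj_range W)).
Proof.
move=> f _ W hW U hU [T uT WE] Lam hLam gap.
have hf : dominated_density f by exact: posterior_dominated.
pose H := @dresponse R L NR NT.
have hH i r s : ctame (fun theta => H i theta r s) by exact: ctame_dresponse.
pose RW := proj_range W.
have RWE : RW = U *m U^t* by rewrite /RW WE proj_range_orthonormal.
have hRW : RW^t* = RW by rewrite RWE trCM trCK.
pose M := sandwich f H RW.
have hM i j : (M i j)^t* = M j i by exact: (sandwich_herm hf hH).
have PmxE S : Ptilde NT f U S = Pmx M S.
  by rewrite (Ptilde_sandwich hf hH) -RWE.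
pose s l := Num.sqrt (q l).
have dualfunE X : dual_objective NT f P q U X = dualfun M (JP f) s P X.
  by rewrite /dual_objective PmxE.
have lmiE RV d : sdr_feasible f P q RW (RV, d) <->
    [/\ lmi M (JP f) s RV d, \tr RV <= P%:C & psdC RV].
  by rewrite /sdr_feasible /J (JD_sandwich hf hH).
have N0 : (0 < NT)%N := leq_ltn_trans (leq0n _) hNT.
(* Without feasible points both infima range over the empty set and agree. *)
have [[x0 hx0]|noF] := pselect (exists x, sdr_feasible (NT := NT) f P q RW x); last first.
  rewrite /optimal_value; congr ereal_inf; apply/seteqP; split => z [x hx _].
    by case: noF; exists x.
  by case: noF; exists x; case: hx.
(* The symmetry of the prior information matrix is read off a feasible point. *)
have hJP : (JP f)^T = JP f.
  case: x0 hx0 => RV d /lmiE[hl _ [hRV _]].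
  have [] := hl (lshift _ (Ordinal hL)); rewrite tr_block_mx => /eq_block_mx[hJ _ _ _] _.
  move: hJ; rewrite /bim trmxD JDmx_sym//; exact: addrI.
have mu0 : 0 <= mu 1 (Pmx M (Lam *m Lam^T)).
  have hS : (Lam *m Lam^T)^T = Lam *m Lam^T by rewrite trmx_mul trmxK.
  have [v [_ _ hv _]] := herm_gap N0 (Pmx_herm hM hS).
  (* A unit vector bounds mu_1 from below by a diagonal entry of [Ptilde], which is nonnegative. *)
  pose e : 'cV[R[i]]_NT := delta_mx (Ordinal N0) 0.
  have e1 : sqnorm e = 1.
    rewrite /sqnorm (bigD1 (Ordinal N0))//= big1 => [|j jN].
      by rewrite /e mxE !eqxx /sqn /= expr1n expr0n !addr0.
    by rewrite /e mxE (negbTE jN) /sqn /= expr0n addr0.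
  have := hv e; rewrite e1 mulr1; apply: le_trans.
  have := Ptilde_gram_diag_ge0 (NT := NT) hf U Lam (Ordinal N0); rewrite PmxE.
  rewrite /form; have -> : e^t* = delta_mx 0 (Ordinal N0).
    by apply/matrixP => i j; rewrite !mxE andbC; case: (_ && _); rewrite (rmorph0, rmorph1).
  by rewrite -rowE -colE !mxE.
have hLam' X : dualfun M (JP f) s P X <= dualfun M (JP f) s P Lam.
  by rewrite -!dualfunE.
rewrite !PmxE in gap.
have [RV [d [h1 h2 h3 h4 h5]]] := rank_one_optimum hM hP N0 hJP hLam' mu0 gap.
apply/eqP; rewrite eq_le; apply/andP; split.
  by apply: ereal_inf_le_tmp => z [x [hx _] <-]; exists x.
(* The rank-one optimum of the relaxation is feasible for the constrained problem because 1 <=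
   [MT]. *)
apply: (@le_trans _ _ (\sum_l d l)%:E).
  apply: ereal_inf_lbound; exists (RV, d) => //; split; first exact/lmiE.
  exact: leq_trans h4 hMT.
apply: le_ereal_inf_tmp => z [[RV' d'] /lmiE[g1 g2 g3] <-].
by rewrite lee_fin; exact: h5.
Qed.
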